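(* Let $VA[\Gamma]$ be a spherical virtual Artin group. Let $w=\big(\prod_{\beta\in\Phi[\Gamma]}\overline{\zeta}_\beta^{\,a_\beta}\big)\theta$ and $w'=\big(\prod_{\beta\in\Phi[\Gamma]}\overline{\zeta}_\beta^{\,b_\beta}\big)\theta$ be elements of $VA[\Gamma]/PVA[\Gamma]'$, with $a_\beta,b_\beta\in\mathbb{Z}$ and $\theta\in W[\Gamma]$, and let $T_\theta$ be a set of representatives of the orbits of $\theta$ on $\{\zeta_\beta\mid\beta\in\Phi[\Gamma]\}$. For $\gamma\in\Phi[\Gamma]$ put $m_\gamma=|\mathcal{O}_\theta(\zeta_\gamma)|$, $c_\gamma=\sum_{\zeta_\beta\in\mathcal{O}_\theta(\zeta_\gamma)}a_\beta$ and $d_\gamma=\sum_{\zeta_\beta\in\mathcal{O}_\theta(\zeta_\gamma)}b_\beta$. Then $w$ and $w'$ are conjugate in $VA[\Gamma]/PVA[\Gamma]'$ if and only if there exists an element $\eta\in VA[\Gamma]/PVA[\Gamma]'$ such that $\overline{\pi}_P(\eta)$ lies in the centralizer of $\theta$ in $W[\Gamma]$ and, writing $\eta\theta\eta^{-1}=\big(\prod_{\beta\in\Phi[\Gamma]}\overline{\zeta}_\beta^{\,f_\beta}\big)\theta$ with $f_\beta\in\mathbb{Z}$, $$\sum_{0\le t\le m_\beta-1}f_{\rho(\theta)^t(\beta)}+c_{\rho(\overline{\pi}_P(\eta))^{-1}(\beta)}=d_\beta\qquad\text{for all }\zeta_\beta\in T_\theta.$$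
   Context: Coxeter data. A Coxeter matrix on a finite set $S$ is a symmetric matrix $(m_{s,t})_{s,t\in S}$ with entries in $\mathbb{N}\cup\{\infty\}$, $m_{s,s}=1$, and $m_{s,t}=m_{t,s}\ge 2$ for $s\ne t$. It is encoded by its Coxeter graph $\Gamma$ (vertex set $S$; edge $\{s,t\}$ iff $m_{s,t}\ge 3$, labelled by $m_{s,t}$ if $m_{s,t}\ge4$). For group elements $x,y$ and $m\ge1$, $\mathrm{Prod}_R(x,y,m)$ denotes the alternating word $\cdots yxy$ of length $m$ (rightmost letter $y$). The Coxeter group $W[\Gamma]$ is generated by $S$ with relations $s^2=1$ for all $s\in S$ and $\mathrm{Prod}_R(t,s,m_{s,t})=\mathrm{Prod}_R(s,t,m_{s,t})$ for $s\neq t$ with $m_{s,t}<\infty$. $VA[\Gamma]$ is called spherical if $W[\Gamma]$ is finite. Virtual Artin group. $VA[\Gamma]$ is the group generated by $\{\sigma_s\mid s\in S\}\sqcup\{\tau_s\mid s\in S\}$ with relations: (1) $\mathrm{Prod}_R(\sigma_t,\sigma_s,m_{s,t})=\mathrm{Prod}_R(\sigma_s,\sigma_t,m_{s,t})$ for $s\ne t$, $m_{s,t}<\infty$; (2) $\mathrm{Prod}_R(\tau_t,\tau_s,m_{s,t})=\mathrm{Prod}_R(\tau_s,\tau_t,m_{s,t})$ for $s\neq t$, $m_{s,t}<\infty$, and $\tau_s^2=1$ for $s\in S$; (3) $\mathrm{Prod}_R(\tau_s,\tau_t,m_{s,t}-1)\,\sigma_s=\sigma_r\,\mathrm{Prod}_R(\tau_s,\tau_t,m_{s,t}-1)$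 for $s\ne t$, $m_{s,t}<\infty$, where $r=s$ if $m_{s,t}$ is even and $r=t$ if $m_{s,t}$ is odd. $PVA[\Gamma]$ is the kernel of $\pi_P: VA[\Gamma]\to W[\Gamma]$, $\pi_P(\sigma_s)=\pi_P(\tau_s)=s$, and $PVA[\Gamma]'$ is its commutator subgroup; $\overline{\pi}_P: VA[\Gamma]/PVA[\Gamma]'\to W[\Gamma]$ is the induced map. The map $\pi_P$ has the section $\iota_W:W[\Gamma]\to VA[\Gamma]$, $\iota_W(s)=\tau_s$, so $VA[\Gamma]/PVA[\Gamma]'\cong (PVA[\Gamma]/PVA[\Gamma]')\rtimes W[\Gamma]$, and $\theta\in W[\Gamma]$ is identified with the class of $\iota_W(\theta)$ in this quotient. Root system. Let $V$ be the real vector space with basis $\{\alpha_s\mid s\in S\}$ and symmetric bilinear form $\langle\alpha_s,\alpha_t\rangle=-2\cos(\pi/m_{s,t})$ if $m_{s,t}<\infty$ and $-2$ if $m_{s,t}=\infty$. The Tits representation $\rho: W[\Gamma]\to \mathrm{GL}(V)$ is $\rho(s)(v)=v-\langle v,\alpha_s\rangle\alpha_s$, and $\Phi[\Gamma]=\{\rho(w)(\alpha_s)\mid s\in S, w\in W[\Gamma]\}$. The elements $\zeta_\beta$. For $\beta=\rho(w)(\alpha_s)\in\Phi[\Gamma]$, $\zeta_\beta:=\iota_W(w)\,\tau_s\sigma_s\,\iota_W(w)^{-1}\in PVA[\Gamma]$ (independent of the choice of $w,s$), and $\overline{\zeta}_\beta$ is its image in $PVA[\Gamma]/PVA[\Gamma]'$.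 The group $PVA[\Gamma]/PVA[\Gamma]'$ is free abelian with basis $\{\overline{\zeta}_\beta\mid \beta\in\Phi[\Gamma]\}$, so every element of $VA[\Gamma]/PVA[\Gamma]'$ is uniquely of the form $\big(\prod_{\beta}\overline{\zeta}_\beta^{\,a_\beta}\big)\theta$ with $a_\beta\in\mathbb{Z}$, $\theta\in W[\Gamma]$. An element $\theta\in W[\Gamma]$ acts on $\{\zeta_\beta\mid\beta\in\Phi[\Gamma]\}$ by $\theta\cdot\zeta_\beta=\zeta_{\rho(\theta)(\beta)}$; $\mathcal{O}_\theta(\zeta_\beta)$ denotes the orbit of $\zeta_\beta$ under the cyclic group generated by $\theta$. *)

(* Defs.v *)
From HB Require Import structures.
From mathcomp Require Import all_boot all_order all_algebra.
From mathcomp Require Import all_classical all_reals all_analysis.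
From mathcomp Require Import finmap ring zify.

Set Implicit Arguments.
Unset Strict Implicit.
Unset Printing Implicit Defensive.

Import Order.TTheory GRing.Theory Num.Theory.

Local Open Scope classical_set_scope.
Local Open Scope quotient_scope.
Local Open Scope group_scope.

(* The letter (x, false) is the generator x, the letter (x, true) its inverse. *)
Definition word (X : choiceType) : choiceType := seq (X * bool)%type.

Definition gword (X : choiceType) (s : seq X) : word X :=
  [seq (x, false) | x <- s].

Definition invw (X : choiceType) (u : word X) : word X :=
  rev [seq (l.1, ~~ l.2) | l <- u].

Inductive pres_eq (X : choiceType) (rels : word X -> word X -> Prop) :
    word X -> word X -> Prop :=
| pres_refl u : pres_eq rels u u
| pres_sym u v : pres_eq rels u v -> pres_eq rels v u
| pres_trans u v w : pres_eq rels u v -> pres_eq rels v w -> pres_eq rels u w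
| pres_cat u u' v v' :
    pres_eq rels u u' -> pres_eq rels v v' -> pres_eq rels (u ++ v) (u' ++ v')
| pres_cancel x e : pres_eq rels [:: (x, e); (x, ~~ e)] [::]
| pres_rel u v : rels u v -> pres_eq rels u v.

Section Presented.
Variables (X : choiceType) (rels : word X -> word X -> Prop).

Definition pres_eqb : rel (word X) := fun u v => `[< pres_eq rels u v >].

Lemma pres_eqb_refl : reflexive pres_eqb.
Proof. by move=> u; apply/asboolP; exact: pres_refl. Qed.

Lemma pres_eqb_sym : symmetric pres_eqb.
Proof. by move=> u v; apply/asboolP/asboolP; exact: pres_sym. Qed.

Lemma pres_eqb_trans : transitive pres_eqb.
Proof.
by move=> v u w /asboolP uv /asboolP vw; apply/asboolP; exact: pres_trans vw.
Qed.

Canonical pres_equiv :=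
  EquivRel pres_eqb pres_eqb_refl pres_eqb_sym pres_eqb_trans.

Definition presented : Type := {eq_quot pres_equiv}.
HB.instance Definition _ := Choice.on presented.
HB.instance Definition _ := EqQuotient.on presented.

Definition pcls (u : word X) : presented := \pi_presented u.
Definition pgen (x : X) : presented := pcls (gword [:: x]).

Lemma pclsP u v : pcls u = pcls v <-> pres_eq rels u v.
Proof.
split=> [/eqP|uv]; first by rewrite /pcls piE => /asboolP.
by apply/eqP; rewrite /pcls piE; apply/asboolP.
Qed.

Lemma pcls_repr (x : presented) : pcls (repr x) = x.
Proof. exact: reprK. Qed.

Lemma pres_reprK u : pres_eq rels (repr (pcls u)) u.
Proof. by apply/pclsP; rewrite pcls_repr. Qed.

Lemma pres_eq_invw u v : pres_eq rels u v -> pres_eq rels (invw u) (invw v).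
Proof.
have invwK w : pres_eq rels (w ++ invw w) [::].
  elim/last_ind: w => [|w [x e] IH]; first exact: pres_refl.
  rewrite /invw map_rcons rev_rcons -/(invw w) /= -cats1 -catA.
  apply: pres_trans IH; apply: pres_cat; first exact: pres_refl.
  apply: (@pres_cat _ _ [:: (x, e); (x, ~~ e)] [::] (invw w) (invw w)).
    exact: pres_cancel.
  exact: pres_refl.
have invwKr w : pres_eq rels (invw w ++ w) [::].
  have := invwK (invw w); rewrite {2}/invw map_rev revK -map_comp.
  rewrite (@eq_map _ _ _ id) ?map_id // => -[x e] /=.
  by rewrite negbK.
move=> uv.
apply: (@pres_trans _ _ _ (invw u ++ (v ++ invw v))).
  rewrite -{1}(cats0 (invw u)); apply: pres_cat; first exact: pres_refl.
  exact: pres_sym.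
rewrite catA -{2}(cat0s (invw v)); apply: pres_cat; last exact: pres_refl.
apply: pres_trans (invwKr u); apply: pres_cat; first exact: pres_refl.
exact: pres_sym.
Qed.

Definition pmul (x y : presented) := pcls (repr x ++ repr y).
Definition pone := pcls [::].
Definition pinv (x : presented) := pcls (invw (repr x)).

Lemma pmul_cls u v : pmul (pcls u) (pcls v) = pcls (u ++ v).
Proof. by apply/pclsP; apply: pres_cat; exact: pres_reprK. Qed.

Lemma pinv_cls u : pinv (pcls u) = pcls (invw u).
Proof. by apply/pclsP; apply: pres_eq_invw; exact: pres_reprK. Qed.

Lemma pmulA : associative pmul.
Proof.
move=> x y z; rewrite -(pcls_repr x) -(pcls_repr y) -(pcls_repr z).
by rewrite !pmul_cls catA.
Qed.

Lemma pmul1 : left_id pone pmul.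
Proof. by move=> x; rewrite -(pcls_repr x) pmul_cls. Qed.

Lemma pmulg1 : right_id pone pmul.
Proof. by move=> x; rewrite -(pcls_repr x) pmul_cls cats0. Qed.

Lemma pmulgV : right_inverse pone pinv pmul.
Proof.
move=> x; rewrite -(pcls_repr x) pinv_cls pmul_cls; apply/pclsP.
elim/last_ind: (repr x) => [|w [y e] IH]; first exact: pres_refl.
rewrite /invw map_rcons rev_rcons -/(invw w) /= -cats1 -catA.
apply: pres_trans IH; apply: pres_cat; first exact: pres_refl.
apply: (@pres_cat _ _ [:: (y, e); (y, ~~ e)] [::] (invw w) (invw w)).
  exact: pres_cancel.
exact: pres_refl.
Qed.

Lemma pmulVg : left_inverse pone pinv pmul.
Proof.
move=> x; rewrite -[X in pmul _ X]pmulg1 -(pmulgV (pinv x)).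
by rewrite !pmulA -(pmulA (pinv x)) pmulgV pmulg1 pmulgV.
Qed.

HB.instance Definition _ :=
  isGroup.Build presented pmulA pmul1 pmulg1 pmulVg pmulgV.

Lemma pclsM u v : pcls (u ++ v) = pcls u * pcls v.
Proof. by rewrite -pmul_cls. Qed.

Section Lift.
Variables (G : groupType) (f : X -> G).

Definition letval (l : X * bool) : G := if l.2 then (f l.1)^-1 else f l.1.
Definition wval (u : word X) : G := \prod_(l <- u) letval l.

Hypothesis f_rels : forall u v, rels u v -> wval u = wval v.

Definition plift (x : presented) : G := wval (repr x).

Lemma wval_pres u v : pres_eq rels u v -> wval u = wval v.
Proof.
elim=> //=.
- by move=> {}u {}v w _ -> _ ->.
- by move=> {}u u' {}v v' _ e1 _ e2; rewrite /wval !big_cat /= -!/(wval _) e1 e2.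
- move=> x e; rewrite /wval !big_cons !big_nil /letval /= mulg1.
  by case: e => /=; rewrite ?mulVg ?mulgV.
Qed.

Lemma plift_cls u : plift (pcls u) = wval u.
Proof. by apply: wval_pres; exact: pres_reprK. Qed.

Lemma plift_gen x : plift (pgen x) = f x.
Proof. by rewrite plift_cls /wval big_seq1. Qed.

Lemma pliftM : {morph plift : x y / x * y}.
Proof.
move=> x y; rewrite -(pcls_repr x) -(pcls_repr y) -pclsM !plift_cls.
by rewrite /wval big_cat.
Qed.

End Lift.
End Presented.

Definition is_subgroup (G : groupType) (H : set G) : Prop :=
  [/\ H 1, forall x y, H x -> H y -> H (x * y) & forall x, H x -> H x^-1].

Definition generated (G : groupType) (A : set G) : set G :=
  [set x | forall H : set G, is_subgroup H -> A `<=` H -> H x].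

Definition is_normal (G : groupType) (H : set G) : Prop :=
  is_subgroup H /\ forall x g, H x -> H (x ^ g).

Definition derived_subgroup (G : groupType) (H : set G) : set G :=
  generated [set z | exists x y, [/\ H x, H y & z = [~ x, y]]].

Lemma generated_subgroup (G : groupType) (A : set G) :
  is_subgroup (generated A).
Proof.
split.
- by move=> H [].
- by move=> x y Hx Hy H sH AH; case: (sH) => _ HM _; apply: HM; [exact: Hx|exact: Hy].
- by move=> x Hx H sH AH; case: (sH) => _ _; apply; exact: Hx.
Qed.

Lemma derived_normal (G : groupType) (H : set G) :
  is_normal H -> is_normal (derived_subgroup H).
Proof.
move=> [sH nH]; split; first exact: generated_subgroup.
move=> x g Dx; apply: (Dx [set y | derived_subgroup H (y ^ g)]).
- have [D1 DM DV] := generated_subgroup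
      [set z | exists x y, [/\ H x, H y & z = [~ x, y]]].
  split=> /= [|y z|y].
  + by rewrite conj1g.
  + by rewrite conjMg; exact: DM.
  + by rewrite conjVg; exact: DV.
- move=> _ [y [z [Hy Hz ->]]] /= K _; apply.
  by exists (y ^ g), (z ^ g); split; [exact: nH|exact: nH|rewrite conjRg].
Qed.

Section Quotient.
Variables (G : groupType) (N : set G) (nN : is_normal N).

Definition qrel : rel G := fun x y => `[< N (x^-1 * y) >].

Lemma qrel_refl : reflexive qrel.
Proof. by move=> x; apply/asboolP; rewrite mulVg; case: nN => -[]. Qed.

Lemma qrel_sym : symmetric qrel.
Proof.
case: nN => -[_ _ NV] _.
by move=> x y; apply/asboolP/asboolP => /NV; rewrite invgM invgK.
Qed.

Lemma qrel_trans : transitive qrel.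
Proof.
case: nN => -[_ NM _] _.
move=> y x z /asboolP xy /asboolP yz; apply/asboolP.
by have := NM _ _ xy yz; rewrite mulgA mulgK.
Qed.

Canonical qrel_equiv := EquivRel qrel qrel_refl qrel_sym qrel_trans.

Definition gquot : Type := {eq_quot qrel_equiv}.
HB.instance Definition _ := Choice.on gquot.
HB.instance Definition _ := EqQuotient.on gquot.

Definition qcls (x : G) : gquot := \pi_gquot x.

Lemma qclsP x y : qcls x = qcls y <-> N (x^-1 * y).
Proof.
split=> [/eqP|xy]; first by rewrite /qcls piE => /asboolP.
by apply/eqP; rewrite /qcls piE; apply/asboolP.
Qed.

Lemma qcls_repr (x : gquot) : qcls (repr x) = x.
Proof. exact: reprK. Qed.

Definition qmul (x y : gquot) := qcls (repr x * repr y).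
Definition qone := qcls 1.
Definition qinv (x : gquot) := qcls (repr x)^-1.

Lemma qmul_cls x y : qmul (qcls x) (qcls y) = qcls (x * y).
Proof.
have [[N1 NM NV] NJ] := nN.
have /qclsP hx := qcls_repr (qcls x).
have /qclsP hy := qcls_repr (qcls y).
apply/qclsP; rewrite invgM.
have := NM _ _ (NJ _ (repr (qcls y)) hx) hy.
by rewrite conjgE !mulgA mulgK.
Qed.

Lemma qinv_cls x : qinv (qcls x) = qcls x^-1.
Proof.
have [[N1 NM NV] NJ] := nN.
have /qclsP hx := qcls_repr (qcls x).
apply/qclsP; rewrite invgK.
by have := NJ _ (repr (qcls x))^-1 (NV _ hx); rewrite conjgE !invgM !invgK !mulgA mulgK.
Qed.

Lemma qmulA : associative qmul.
Proof.
move=> x y z; rewrite -(qcls_repr x) -(qcls_repr y) -(qcls_repr z).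
by rewrite !qmul_cls mulgA.
Qed.

Lemma qmul1 : left_id qone qmul.
Proof. by move=> x; rewrite -(qcls_repr x) qmul_cls mul1g. Qed.

Lemma qmulg1 : right_id qone qmul.
Proof. by move=> x; rewrite -(qcls_repr x) qmul_cls mulg1. Qed.

Lemma qmulVg : left_inverse qone qinv qmul.
Proof. by move=> x; rewrite -(qcls_repr x) qinv_cls qmul_cls mulVg. Qed.

Lemma qmulgV : right_inverse qone qinv qmul.
Proof. by move=> x; rewrite -(qcls_repr x) qinv_cls qmul_cls mulgV. Qed.

HB.instance Definition _ :=
  isGroup.Build gquot qmulA qmul1 qmulg1 qmulVg qmulgV.

Lemma qclsM : {morph qcls : x y / x * y}.
Proof. by move=> x y; rewrite -qmul_cls. Qed.

End Quotient.

(* [None] stands for the label infinity. *)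
Record coxeter_matrix (S : finType) := CoxeterMatrix {
  cox_entry :> S -> S -> option nat;
  cox_diag : forall s, cox_entry s s = Some 1%N;
  cox_sym : forall s t, cox_entry s t = cox_entry t s;
  cox_off : forall s t m, s != t -> cox_entry s t = Some m -> (2 <= m)%N
}.

(* [:: ...; y; x; y], of length m: the letters of Prod_R(x, y, m). *)
Fixpoint alt (T : Type) (x y : T) (m : nat) : seq T :=
  if m is m'.+1 then (if odd m' then x else y) :: alt x y m' else [::].

Lemma alt_rcons (T : Type) (x y : T) m : alt x y m.+1 = rcons (alt y x m) y.
Proof.
elim: m => // m IH; rewrite [LHS]/= -/(alt x y m.+1) IH [alt y x m.+1]/=.
by rewrite rcons_cons; case: (odd m).
Qed.

Lemma map_alt (T U : Type) (f : T -> U) x y m :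
  map f (alt x y m) = alt (f x) (f y) m.
Proof. by elim: m => //= m ->; case: (odd m). Qed.

Lemma wval_gword (X : choiceType) (G : groupType) (f : X -> G) (s : seq X) :
  wval f (gword s) = \prod_(x <- s) f x.
Proof. by rewrite /wval /gword big_map. Qed.

Section CoxeterGroup.
Variables (S : finType) (M : coxeter_matrix S).

Inductive cox_rel : word S -> word S -> Prop :=
| cox_square s : cox_rel (gword [:: s; s]) (gword [::])
| cox_braid s t m : s != t -> M s t = Some m ->
    cox_rel (gword (alt t s m)) (gword (alt s t m)).

Definition coxeter_group : groupType := presented cox_rel.

Definition cox_gen (s : S) : coxeter_group := pgen cox_rel s.

Lemma cox_gen2 s : cox_gen s * cox_gen s = 1.
Proof.
rewrite /cox_gen /pgen -pclsM; apply/pclsP; apply: pres_rel.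
exact: cox_square.
Qed.

Lemma prod_cox_gen (u : seq S) :
  \prod_(s <- u) cox_gen s = pcls cox_rel (gword u) :> coxeter_group.
Proof.
elim: u => [|s u IH]; first by rewrite big_nil.
by rewrite big_cons IH /cox_gen /pgen -pclsM.
Qed.

Lemma cox_gen_braid s t m : s != t -> M s t = Some m ->
  \prod_(x <- alt t s m) cox_gen x = \prod_(x <- alt s t m) cox_gen x.
Proof.
move=> st stm; rewrite !prod_cox_gen; apply/pclsP; apply: pres_rel.
exact: cox_braid.
Qed.

Definition sig_letter (s : S) : S + S := inl s.
Definition tau_letter (s : S) : S + S := inr s.

Inductive va_rel : word (S + S)%type -> word (S + S)%type -> Prop :=
| va_sigma s t m : s != t -> M s t = Some m ->
    va_rel (gword (alt (sig_letter t) (sig_letter s) m))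
           (gword (alt (sig_letter s) (sig_letter t) m))
| va_tau s t m : s != t -> M s t = Some m ->
    va_rel (gword (alt (tau_letter t) (tau_letter s) m))
           (gword (alt (tau_letter s) (tau_letter t) m))
| va_tau_square s : va_rel (gword [:: tau_letter s; tau_letter s]) (gword [::])
| va_mixed s t m : s != t -> M s t = Some m ->
    va_rel
      (gword (alt (tau_letter s) (tau_letter t) m.-1 ++ [:: sig_letter s]))
      (gword (sig_letter (if odd m then t else s)
                :: alt (tau_letter s) (tau_letter t) m.-1)).

Definition virtual_artin : groupType := presented va_rel.

Definition sigma (s : S) : virtual_artin := pgen va_rel (sig_letter s).
Definition tau (s : S) : virtual_artin := pgen va_rel (tau_letter s).

Definition piP_gen (l : S + S) : coxeter_group :=
  match l with inl s => cox_gen s | inr s => cox_gen s end.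

Lemma piP_rels u v : va_rel u v -> wval piP_gen u = wval piP_gen v.
Proof.
have E s (f : S -> S + S) : (forall x, piP_gen (f x) = cox_gen x) ->
    \prod_(x <- map f s) piP_gen x = \prod_(x <- s) cox_gen x.
  by move=> fE; rewrite big_map; apply: eq_bigr.
have Es s := E s sig_letter (fun=> erefl).
have Et s := E s tau_letter (fun=> erefl).
case=> [s t m st stm|s t m st stm|s|s t m st stm]; rewrite !wval_gword.
- by rewrite -!map_alt !Es; exact: cox_gen_braid.
- by rewrite -!map_alt !Et; exact: cox_gen_braid.
- by rewrite big_cons big_seq1 big_nil /= cox_gen2.
- have m2 := cox_off st stm; case: m m2 stm => // m _ stm /=.
  rewrite big_cons big_cat big_seq1 -!map_alt !Et /=.
  have -> : cox_gen (if ~~ odd m then t else s) *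
      \prod_(x <- alt s t m) cox_gen x = \prod_(x <- alt s t m.+1) cox_gen x.
    by rewrite /= big_cons; case: (odd m).
  have -> : cox_gen s = \prod_(x <- [:: s]) cox_gen x by rewrite big_seq1.
  rewrite -big_cat cats1 -alt_rcons; exact: cox_gen_braid.
Qed.

Definition piP : virtual_artin -> coxeter_group := plift piP_gen.

Lemma piP_sigma s : piP (sigma s) = cox_gen s.
Proof. exact: (plift_gen piP_rels). Qed.

Lemma piP_tau s : piP (tau s) = cox_gen s.
Proof. exact: (plift_gen piP_rels). Qed.

Lemma piPM : {morph piP : x y / x * y}.
Proof. exact: (pliftM piP_rels). Qed.

Lemma tau_rels u v : cox_rel u v -> wval tau u = wval tau v.
Proof.
have E (w : seq S) :
    \prod_(s <- w) tau s = pcls va_rel (gword (map tau_letter w)).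
  elim: w => [|s w IH]; first by rewrite big_nil.
  by rewrite big_cons IH /tau /pgen -pclsM.
case=> [s|s t m st stm]; rewrite !wval_gword !E; apply/pclsP; apply: pres_rel.
  exact: va_tau_square.
by rewrite !map_alt; exact: va_tau.
Qed.

Definition iotaW : coxeter_group -> virtual_artin := plift tau.

Lemma iotaW_gen s : iotaW (cox_gen s) = tau s.
Proof. exact: (plift_gen tau_rels). Qed.

Lemma iotaWM : {morph iotaW : x y / x * y}.
Proof. exact: (pliftM tau_rels). Qed.

Definition PVA : set virtual_artin := [set x | piP x = 1].

Lemma piP1 : piP 1 = 1.
Proof. by apply: (mulgI (piP 1)); rewrite -piPM !mulg1. Qed.

Lemma piPV x : piP x^-1 = (piP x)^-1.
Proof. by apply: (mulgI (piP x)); rewrite -piPM !mulgV piP1. Qed.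

Lemma PVA_normal : is_normal PVA.
Proof.
rewrite /PVA; split=> [|x g /= x1].
  split=> /= [|x y|x]; first exact: piP1.
    by rewrite piPM => -> ->; rewrite mulg1.
  by rewrite piPV => ->; rewrite invg1.
by rewrite conjgE !piPM piPV x1 mul1g mulVg.
Qed.

Definition PVA' : set virtual_artin := derived_subgroup PVA.

Lemma PVA'_normal : is_normal PVA'.
Proof. exact: derived_normal PVA_normal. Qed.

Definition VA_mod_PVA' : groupType := gquot PVA'_normal.

Definition cls (x : virtual_artin) : VA_mod_PVA' := qcls PVA'_normal x.

Lemma clsM : {morph cls : x y / x * y}.
Proof. exact: qclsM. Qed.

Definition piPbar (x : VA_mod_PVA') : coxeter_group := piP (repr x).

Lemma piPbar_cls x : piPbar (cls x) = piP x.
Proof.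
have /qclsP : cls (repr (cls x)) = cls x by exact: qcls_repr.
have PS : is_subgroup PVA by case: PVA_normal.
move=> /(_ PVA PS) h.
have : PVA ((repr (cls x))^-1 * x).
  apply: h => _ [y [z [Py Pz ->]]].
  by rewrite /PVA /= /commg /conjg !piPM !piPV Py Pz invg1 !mulg1.
rewrite /PVA /= piPM piPV => e.
by rewrite -[RHS](mulVKg (piP (repr (cls x)))) e mulg1.
Qed.

End CoxeterGroup.

Section TitsRepresentation.
Variables (R : realType) (S : finType) (M : coxeter_matrix S).
Local Open Scope ring_scope.

Definition rootV : choiceType := {ffun S -> R}.
Lemma scalerE (a b : R) : a *: (b : R^o) = a * b.
Proof. by []. Qed.

Implicit Types v w : {ffun S -> R}.

Definition alpha (s : S) : {ffun S -> R} := [ffun t => (t == s)%:R].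

Definition cox_form (s t : S) : R :=
  if M s t is Some m then - 2 * cos (pi / m%:R) else - 2.

Definition bform v w : R := \sum_s \sum_t v s * w t * cox_form s t.

Definition reflection (s : S) v : {ffun S -> R} := v - bform v (alpha s) *: alpha s.

Lemma bform_alphar v s : bform v (alpha s) = \sum_t v t * cox_form t s.
Proof.
apply: eq_bigr => t _; rewrite (bigD1 s) //= ffunE eqxx mulr1 big1 ?addr0 //.
by move=> r /negPf rs; rewrite ffunE rs mulr0 mul0r.
Qed.

Lemma bform_alpha s t : bform (alpha s) (alpha t) = cox_form s t.
Proof.
rewrite bform_alphar (bigD1 s) //= ffunE eqxx mul1r big1 ?addr0 //.
by move=> r /negPf rs; rewrite ffunE rs mul0r.
Qed.

Lemma cox_formC s t : cox_form s t = cox_form t s.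
Proof. by rewrite /cox_form cox_sym. Qed.

Lemma cox_form_diag s : cox_form s s = 2.
Proof. by rewrite /cox_form cox_diag divr1 cospi mulrN1 opprK. Qed.

Lemma bform_lin v w s a :
  bform (v + a *: w) (alpha s) = bform v (alpha s) + a * bform w (alpha s).
Proof.
rewrite !bform_alphar mulr_sumr -big_split; apply: eq_bigr => t _ /=.
by rewrite !ffunE mulrDl mulrA.
Qed.

Lemma reflection_linear s a v w :
  reflection s (a *: v + w) = a *: reflection s v + reflection s w.
Proof.
rewrite /reflection (addrC (a *: v)) bform_lin; apply/ffunP => t; rewrite !ffunE /= !scalerE; ring.
Qed.

Lemma reflectionK s : involutive (reflection s).
Proof.
move=> v; rewrite /reflection -scaleNr bform_lin bform_alpha cox_form_diag.
apply/ffunP => t; rewrite !ffunE /= !scalerE; ring.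
Qed.

(* (cheb c n).1 = sin (n x) / sin x when c = 2 cos x. *)
Fixpoint cheb (c : R) (n : nat) : R * R :=
  if n is n'.+1 then let: (x, y) := cheb c n' in (y, c * y - x) else (0, 1).
Let U c n := (cheb c n).1.

Let US c n : U c n.+2 = c * U c n.+1 - U c n.
Proof. by rewrite /U /=; case: (cheb c n). Qed.

Let Uinv c n : U c n.+1 ^+ 2 = 1 - U c n ^+ 2 + c * U c n * U c n.+1.
Proof.
elim: n => [|n IH]; first by rewrite /U /=; ring.
by rewrite US; ring: IH.
Qed.

Let Usin x n : U (2 * cos x) n * sin x = sin (x *+ n).
Proof.
elim/ltn_ind: n => -[|[|n]] IH; first by rewrite /U /= mul0r sin0.
  by rewrite /U /= mul1r.
rewrite US mulrBl -[X in X - _]mulrA (IH n.+1) // (IH n) //.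
rewrite (mulrSr x n.+1) (_ : x *+ n = x *+ n.+1 - x); last by rewrite mulrSr addrK.
rewrite sinB sinD; ring.
Qed.

Lemma iter_reflections s t v n :
  let c := - cox_form s t in
  let p := bform v (alpha s) in let q := bform v (alpha t) in
  foldr reflection v (alt t s n.*2.+1) =
    v - (p * U c n.+1 ^+ 2 + q * U c n * U c n.+1) *: alpha s
      - (p * U c n * U c n.+1 + q * U c n ^+ 2) *: alpha t /\
  foldr reflection v (alt t s n.+1.*2) =
    v - (p * U c n.+1 ^+ 2 + q * U c n * U c n.+1) *: alpha s
      - (p * U c n.+1 * U c n.+2 + q * U c n.+1 ^+ 2) *: alpha t.
Proof.
move=> c p q.
have E2 x x' y y' : x = x' -> y = y' -> v - x *: alpha s - y *: alpha t =
    v - x' *: alpha s - y' *: alpha t by move=> -> ->.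
have cst : cox_form s t = - c by rewrite /c opprK.
have cts : cox_form t s = - c by rewrite cox_formC.
have rs x y : reflection s (v - x *: alpha s - y *: alpha t) =
    v - (p - x + c * y) *: alpha s - y *: alpha t.
  rewrite /reflection -!scaleNr !bform_lin !bform_alpha cox_form_diag cts -/p.
  by apply/ffunP => r; rewrite !ffunE /= !scalerE; ring.
have rt x y : reflection t (v - x *: alpha s - y *: alpha t) =
    v - x *: alpha s - (q - y + c * x) *: alpha t.
  rewrite /reflection -!scaleNr !bform_lin !bform_alpha cox_form_diag cst -/q.
  by apply/ffunP => r; rewrite !ffunE /= !scalerE; ring.
have next n' x y : foldr reflection v (alt t s n'.*2.+1) =
      v - x *: alpha s - y *: alpha t ->
    foldr reflection v (alt t s n'.+1.*2) =
      v - x *: alpha s - (q - y + c * x) *: alpha t.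
  by rewrite doubleS => e; rewrite /= odd_double /= -rt -e /= odd_double.
have next' n' x y : foldr reflection v (alt t s n'.*2) =
      v - x *: alpha s - y *: alpha t ->
    foldr reflection v (alt t s n'.*2.+1) =
      v - (p - x + c * y) *: alpha s - y *: alpha t.
  by move=> e; rewrite /= odd_double /= -rs -e.
suff H : foldr reflection v (alt t s n.*2.+1) =
    v - (p * U c n.+1 ^+ 2 + q * U c n * U c n.+1) *: alpha s
      - (p * U c n * U c n.+1 + q * U c n ^+ 2) *: alpha t.
  split=> //; rewrite (next _ _ _ H); apply: E2 => //.
  by rewrite US; ring: (Uinv c n).
elim: n => [|n IH].
  rewrite (next' 0%N 0 0); first by apply: E2; rewrite /U /=; ring.
  by rewrite /= !scale0r !subr0.
rewrite (next' _ _ _ (next _ _ _ IH)); apply: E2.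
  by rewrite !US; ring: (Uinv c n).
by rewrite !US; ring: (Uinv c n).
Qed.

Lemma reflection_braid s t m v : s != t -> M s t = Some m ->
  foldr reflection v (alt t s m) = foldr reflection v (alt s t m).
Proof.
move=> st stm; have m2 := cox_off st stm.
have m0 : (0 < m)%N by exact: leq_trans m2.
have cE : - cox_form s t = 2 * cos (pi / m%:R).
  by rewrite /cox_form stm mulNr opprK.
have cE' : - cox_form t s = 2 * cos (pi / m%:R) by rewrite cox_formC.
set x := pi / m%:R in cE cE'.
have mx : x *+ m = pi :> R.
  by rewrite -mulr_natr /x divfK // pnatr_eq0 -lt0n.
have sx : sin x != 0.
  rewrite gt_eqF // sin_gt0_pi // /x divr_gt0 ?pi_gt0 ?ltr0n //=.
  by rewrite ltr_pdivrMr ?ltr0n // ltr_pMr ?pi_gt0 // ltr1n.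
have Usym i j : (i + j = m)%N -> U (2 * cos x) i = U (2 * cos x) j.
  move=> ij; apply: (mulIf sx); rewrite !Usin.
  have -> : x *+ i = pi - x *+ j by rewrite -mx -ij mulrnDr addrK.
  by rewrite sinB sinpi cospi; ring.
have [modd|meven] := boolP (odd m).
  have em : m = (m./2).*2.+1 by rewrite -{1}(odd_double_half m) modd.
  set n := m./2 in em.
  rewrite em (iter_reflections s t v n).1 (iter_reflections t s v n).1 cE cE'.
  have -> : U (2 * cos x) n.+1 = U (2 * cos x) n by apply: Usym; lia.
  by apply/ffunP => r; rewrite !ffunE /= !scalerE; ring.
have em : m = (m./2.-1).+1.*2 by lia.
set n := m./2.-1 in em.
rewrite em (iter_reflections s t v n).2 (iter_reflections t s v n).2 cE cE'.
have -> : U (2 * cos x) n.+2 = U (2 * cos x) n by apply: Usym; lia.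
by apply/ffunP => r; rewrite !ffunE /= !scalerE; ring.
Qed.

(* Inverse letters act as the generators do, reflections being involutive. *)
Definition word_act (u : word S) v := foldr (fun l => reflection l.1) v u.

Lemma word_act_pres u u' v :
  pres_eq (cox_rel M) u u' -> word_act u v = word_act u' v.
Proof.
have gw (b : seq S) z : word_act (gword b) z = foldr reflection z b.
  by elim: b => //= s b ->.
move=> e; elim: e v => //=.
- by move=> {}u {}u' u'' _ IH _ IH' v; rewrite IH.
- by move=> a a' b b' _ IH _ IH' v; rewrite /word_act !foldr_cat -!/(word_act _ _) IH IH'.
- by move=> s b v; rewrite reflectionK.
- move=> a b [s|s t m st stm] v; rewrite !gw /= ?reflectionK //.
  exact: reflection_braid.
Qed.

Definition rho (w : coxeter_group M) : rootV -> rootV := word_act (repr w).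

Lemma rho_cls u v : rho (pcls _ u) v = word_act u v.
Proof. by apply: word_act_pres; exact: pres_reprK. Qed.

Lemma rho_gen s v : rho (cox_gen M s) v = v - bform v (alpha s) *: alpha s.
Proof. exact: rho_cls. Qed.

Lemma rho1 v : rho 1%g v = v.
Proof. exact: rho_cls. Qed.

Lemma rhoM (w w' : coxeter_group M) v : rho (w * w')%g v = rho w (rho w' v).
Proof.
rewrite -(pcls_repr w) -(pcls_repr w') -pclsM !rho_cls.
by rewrite /word_act foldr_cat.
Qed.

Lemma rhoK (w : coxeter_group M) : cancel (rho w) (rho w^-1%g).
Proof. by move=> v; rewrite -rhoM mulVg rho1. Qed.

Lemma rho_linear (w : coxeter_group M) a (v v' : {ffun S -> R}) :
  rho w (a *: v + v') = a *: (rho w v : {ffun S -> R}) + rho w v'.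
Proof.
rewrite /rho /word_act; elim: (repr w) => //= l u ->.
exact: reflection_linear.
Qed.

Definition Phi : set rootV := [set b | exists (w : coxeter_group M) (s : S), b = rho w (alpha s)].

End TitsRepresentation.

Arguments alpha R {S} s.
Arguments Phi R {S} M.

Section Zeta.
Variables (R : realType) (S : finType) (M : coxeter_matrix S).
Notation V := (rootV R S).
Notation W := (coxeter_group M).
Notation VA := (virtual_artin M).
Notation VAab := (VA_mod_PVA' M).

Definition spherical : Prop := finite_set [set: W].

(* The value does not depend on the chosen pair (w, s) with b = rho w alpha_s;
   outside Phi it is the junk value 1. *)
Definition zeta (b : V) : VA :=
  match pselect (exists ws : W * S, b = rho ws.1 (alpha R ws.2)) with
  | left bP => let: (w, s) := projT1 (cid bP) in
      iotaW w * (tau M s * sigma M s) * (iotaW w)^-1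
  | right _ => 1
  end.

Definition zetabar (b : V) : VAab := cls (zeta b).

(* The class identified with th in the semidirect product decomposition. *)
Definition clsW (th : W) : VAab := cls (iotaW th).

Definition zpow (G : groupType) (x : G) (k : int) : G :=
  match k with Posz n => x ^+ n | Negz n => x ^- n.+1 end.

(* Phi is finite when M is spherical, and the classes zetabar b commute, so
   that the enumeration order of Phi is irrelevant. Values of [a] outside Phi
   are ignored. *)
Definition zeta_prod (a : V -> int) : VAab :=
  \prod_(b <- fset_set (Phi R M)) zpow (zetabar b) (a b).

Definition cyclic_subgroup (th : W) : set W := [set zpow th k | k in [set: int]].

(* The orbit of zeta_b, for the action h . zeta_b = zeta_(rho h b). *)
Definition zorbit (th : W) (b : V) : set VA :=
  [set zeta (rho h b) | h in cyclic_subgroup th].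

Definition orbit_representatives (th : W) (T : set VA) : Prop :=
  T `<=` [set zeta b | b in Phi R M] /\
  forall b, Phi R M b -> exists! x, T x /\ zorbit th b x.

Definition orbit_size (th : W) (b : V) : nat := #|` fset_set (zorbit th b)|%fset.

Definition orbit_sum (th : W) (a : V -> int) (b : V) : int :=
  (\sum_(g <- fset_set [set g | Phi R M g /\ zorbit th b (zeta g)]) a g)%R.

Definition conjugate (G : groupType) (x y : G) : Prop :=
  exists g, y = g * x * g^-1.

Definition centralizer (G : groupType) (x : G) : set G := [set y | commute y x].

End Zeta.

(* Main.v *)
Require Import Defs.
From HB Require Import structures.
From mathcomp Require Import all_boot all_order all_algebra.
From mathcomp Require Import all_classical all_reals all_analysis.
From mathcomp Require Import finmap ring zify.

(* A word w with w alpha_s simple conjugates zeta_(alpha_s) to zeta_(w alpha_s):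
   factor w = v d with d in the dihedral group of s and the last letter t of w,
   and v minimal. As v alpha_s and v alpha_t are nonnegative, w alpha_s can only
   be simple when d alpha_s is alpha_s or alpha_t, and then d is the alternating
   word of a mixed relation; v is shorter than w. The same induction shows that
   w alpha_s is nonnegative when w is not longer than w s, by Humphreys'
   argument (Reflection Groups and Coxeter Groups, section 5.4).

   Hence VA/PVA' is generated by W and the commuting classes of the zeta_b, which
   W permutes like the roots. Sending tau_s to s and sigma_s to s * delta_(alpha_s)
   defines a morphism to the semidirect product of W and the integer functions on
   roots, which separates the products of the zeta_b. So an element of VA/PVA' is
   known by its image theta in W and its coefficients. Conjugating by an element
   of the kernel changes the coefficients by h - h o theta^-1, and on a finite
   cycle every function of zero sum is of this form. *)

Set Implicit Arguments.
Unset Strict Implicit.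
Unset Printing Implicit Defensive.

Import Order.TTheory GRing.Theory Num.Theory.

Local Open Scope group_scope.

(** * Reflections in the rank two case *)

Section Cheb.
Variable R : realType.
Local Open Scope ring_scope.

Lemma chebSS (c : R) n :
  (cheb c n.+2).1 = c * (cheb c n.+1).1 - (cheb c n).1.
Proof. by rewrite /=; case: (cheb c n). Qed.

Lemma cheb_sin (x : R) n : (cheb (2 * cos x) n).1 * sin x = sin (x *+ n).
Proof.
elim/ltn_ind: n => -[|[|n]] IH; rewrite ?mul0r ?mul1r ?sin0 //.
rewrite chebSS mulrBl -[X in X - _]mulrA (IH n.+1) // (IH n) //.
rewrite (mulrSr x n.+1) (_ : x *+ n = x *+ n.+1 - x); last by rewrite mulrSr addrK.
by rewrite sinB sinD; ring.
Qed.

(** The label infinity gives the form value -2, hence the parameter 2, where sin (n x) / sin x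
    degenerates to its limit at x = 0. *)
Lemma cheb2 n : (cheb (2 : R) n).1 = n%:R.
Proof.
elim/ltn_ind: n => -[|[|n]] IH //.
by rewrite chebSS (IH n.+1) // (IH n) // -[n.+2]addn2 -[n.+1]addn1 !natrD; ring.
Qed.

Section Finite.
Variable m : nat.
Hypothesis m_gt1 : (1 < m)%N.
Let x : R := pi / m%:R.

Let m_gt0 : (0 < m)%N. Proof. exact: ltnW. Qed.

Let sin_gt0 k : (0 < k < m)%N -> 0 < sin (x *+ k).
Proof.
move=> /andP[k0 km]; apply: sin_gt0_pi; rewrite pmulrn_lgt0 //.
rewrite divr_gt0 ?pi_gt0 ?ltr0n //= -mulr_natr /x mulrAC.
by rewrite ltr_pdivrMr ?ltr0n // ltr_pM2l ?pi_gt0 // ltr_nat.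
Qed.

Let sinx_gt0 : 0 < sin x.
Proof. by have := @sin_gt0 1%N; apply. Qed.

Lemma cheb_gt0 k : (0 < k < m)%N -> 0 < (cheb (2 * cos (pi / m%:R) : R) k).1.
Proof. by move=> km; rewrite -(pmulr_lgt0 _ sinx_gt0) cheb_sin sin_gt0. Qed.

(** Both sides are sine quotients at x = pi / m, and sin (pi - y) = sin y. *)
Lemma cheb_sym i j : (i + j = m)%N ->
  (cheb (2 * cos (pi / m%:R) : R) i).1 = (cheb (2 * cos (pi / m%:R)) j).1.
Proof.
move=> ij; apply: (mulIf (lt0r_neq0 sinx_gt0)); rewrite !cheb_sin.
have -> : x *+ i = pi - x *+ j.
  have <- : x *+ m = pi by rewrite -mulr_natr /x divfK // pnatr_eq0 -lt0n.
  by rewrite -ij mulrnDr addrK.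
by rewrite sinB sinpi cospi; ring.
Qed.

End Finite.
End Cheb.

Section Rank2.
Variables (R : realType) (S : finType) (M : coxeter_matrix S).
Local Open Scope ring_scope.
Implicit Types (s t : S).

Definition comb2 (p q : R) (s t : S) : {ffun S -> R} :=
  p *: alpha R s + q *: alpha R t.

Lemma comb2C p q s t : comb2 p q s t = comb2 q p t s.
Proof. exact: addrC. Qed.

Lemma reflection_comb2 p q s t :
  reflection M s (comb2 p q s t) = comb2 (- p - q * cox_form R M s t) q s t.
Proof.
rewrite /comb2 reflection_linear /reflection.
have -> : q *: alpha R t = 0 + q *: alpha R t by rewrite add0r.
rewrite bform_lin !bform_alpha cox_form_diag (cox_formC R M t s).
have -> : bform M (0 : {ffun S -> R}) (alpha R s) = 0.
  by rewrite bform_alphar big1 // => r _; rewrite ffunE mul0r.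
by apply/ffunP => r; rewrite !ffunE /= !scalerE; ring.
Qed.

(** Each further reflection changes only the older coordinate, replacing it by the next term of the
    recursion of [cheb]. *)
Lemma alt_reflections_alpha s t k (U := fun n => (cheb (- cox_form R M s t) n).1) :
  foldr (reflection M) (alpha R s) (alt s t k) =
  if odd k then comb2 (U k) (U k.+1) s t else comb2 (U k.+1) (U k) s t.
Proof.
have US n : U n.+2 = - cox_form R M s t * U n.+1 - U n by exact: chebSS.
elim: k => [|k IH]; first by rewrite /comb2 /U /= scale1r scale0r addr0.
rewrite [alt s t k.+1]/= [foldr _ _ _]/= IH /= -/(odd k).
case: (odd k) => /=.
  by rewrite reflection_comb2 US; congr comb2; ring.
rewrite comb2C reflection_comb2 comb2C cox_formC US.
by congr comb2; ring.
Qed.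

(* The k-th inversion root of the alternating word ... s t s *)
Lemma alt_reflections_root s t k (U := fun n => (cheb (- cox_form R M s t) n).1) :
  foldr (reflection M) (comb2 (U k.+1) (U k) s t) (alt t s k) =
  alpha R (if odd k then t else s).
Proof.
rewrite /U; elim: k s t {U} => [|k IH] s t.
  by rewrite /comb2 /= scale1r scale0r addr0.
rewrite alt_rcons -cats1 foldr_cat /= reflection_comb2 (chebSS _ k).
rewrite comb2C; set c := cox_form R M s t.
have -> : - (- c * (cheb (- c) k.+1).1 - (cheb (- c) k).1) -
  (cheb (- c) k.+1).1 * c = (cheb (- c) k).1 by ring.
by rewrite /c cox_formC IH; case: (odd k).
Qed.

Lemma rho_prod (u : seq S) (v : rootV R S) :
  rho (\prod_(s <- u) cox_gen M s)%g v = foldr (reflection M) v u.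
Proof.
elim: u => [|s u IH]; first by rewrite big_nil rho1.
by rewrite big_cons rhoM IH rho_gen.
Qed.

End Rank2.

(** * Length and dihedral factorization *)

Section Length.
Variables (S : finType) (M : coxeter_matrix S).
Notation W := (coxeter_group M).
Implicit Types (s t : S) (u d : seq S) (v w : W).

Definition cox_prod u : W := \prod_(s <- u) cox_gen M s.

Lemma cox_prod_cat u d : cox_prod (u ++ d) = cox_prod u * cox_prod d.
Proof. exact: big_cat. Qed.

Lemma cox_prod_cons s u : cox_prod (s :: u) = cox_gen M s * cox_prod u.
Proof. exact: big_cons. Qed.

Lemma cox_prod_rcons u s : cox_prod (rcons u s) = cox_prod u * cox_gen M s.
Proof. by rewrite -cats1 cox_prod_cat /cox_prod big_seq1. Qed.

Lemma cox_genV s : (cox_gen M s)^-1 = cox_gen M s.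
Proof. by apply: mulg1_eq; exact: cox_gen2. Qed.

Lemma cox_genK s w : w * cox_gen M s * cox_gen M s = w.
Proof. by rewrite -mulgA cox_gen2 mulg1. Qed.

Lemma cox_prod_surj w : exists u, cox_prod u = w.
Proof.
rewrite -(pcls_repr w); elim: (repr w) => [|[s e] u [d dE]].
  by exists [::]; rewrite /cox_prod big_nil.
exists (s :: d); rewrite cox_prod_cons dE -cat1s pclsM; congr (_ * _).
case: e => //; rewrite -cox_genV /cox_gen /pgen.
exact: (pinv_cls (cox_rel M)).
Qed.

Fact len_subproof w : exists n, `[< exists2 u, size u = n & cox_prod u = w >].
Proof. by have [u uw] := cox_prod_surj w; exists (size u); apply/asboolP; exists u. Qed.

Definition len w : nat := ex_minn (len_subproof w).

Lemma len_word w : exists2 u, size u = len w & cox_prod u = w.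
Proof. by rewrite /len; case: ex_minnP => n /asboolP. Qed.

Lemma len_le u : (len (cox_prod u) <= size u)%N.
Proof. by rewrite /len; case: ex_minnP => n _; apply; apply/asboolP; exists u. Qed.

Lemma lenM v w : (len (v * w) <= len v + len w)%N.
Proof.
have [u <- <-] := len_word v; have [d <- <-] := len_word w.
by rewrite -cox_prod_cat -size_cat len_le.
Qed.

(** Stripping the last letter exchanges the roles of [s] and [t]: without repetitions, what remains
    cannot end in [t]. *)
Lemma alternating_alt s t d : all (mem [:: s; t]) d ->
    (forall d1 d2 r, d <> d1 ++ [:: r, r & d2]) ->
    (forall d1, d <> rcons d1 s) ->
  d = alt s t (size d).
Proof.
elim/last_ind: d s t => [|d r IH] s t //.
rewrite all_rcons /= !inE => /andP[/orP[] /eqP -> dst] nrep nlast.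
  by case: (nlast d).
rewrite size_rcons alt_rcons -IH //.
- by apply: sub_all dst => x; rewrite !inE orbC.
- by move=> d1 d2 x e; apply: (nrep d1 (rcons d2 t) x); rewrite e rcons_cat.
- by move=> d1 e; apply: (nrep d1 [::] t); rewrite e -!cats1 -catA.
Qed.

Lemma alt_addn s t i j : exists2 d, size d = i & alt s t (i + j) = d ++ alt s t j.
Proof.
elim: i => [|i [d di IH]]; first by exists [::].
by exists ((if odd (i + j) then s else t) :: d); rewrite /= ?di ?IH.
Qed.

(* t is the last letter of a reduced word for w. Maximizing the dihedral factor
   makes v minimal in its coset. *)
Lemma dihedral_factor w s : w <> 1 -> (len w <= len (w * cox_gen M s))%N ->
  exists v t k, [/\ s != t, w = v * cox_prod (alt s t k.+1),
    (len v < len w)%N,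
    (len v <= len (v * cox_gen M s))%N /\ (len v <= len (v * cox_gen M t))%N &
    forall m, M s t = Some m -> (k.+1 < m)%N].
Proof.
move=> w1 ws; have [u] := len_word w.
case/lastP: u => [|u t]; first by rewrite /cox_prod big_nil => _ /esym.
rewrite size_rcons cox_prod_rcons => ulen uw.
have st : s != t.
  apply/eqP => st; have := len_le u.
  by move: ws; rewrite -ulen -uw st cox_genK; lia.
(* The last inequality makes lengths add up in w = v d, as subadditivity gives the converse
   bound. *)
pose P n := `[< exists v d, [/\ all (mem [:: s; t]) d, size d = n,
                                w = v * cox_prod d & (len v + n <= len w)%N] >].
have P1 : P 1%N.
  apply/asboolP; exists (cox_prod u), [:: t]; split; rewrite /= ?inE ?eqxx ?orbT //.
    by rewrite /cox_prod big_seq1.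
  by have := len_le u; lia.
have Pw n : P n -> (n <= len w)%N by move=> /asboolP[v [d []]]; lia.
case: (ex_maxnP (ex_intro P 1%N P1) Pw) => n /asboolP[v [d [dst dn wE vn]]] nmax.
have n0 := nmax _ P1.
have short (x : W) d' : x = v * cox_prod d' -> (len x <= len v + size d')%N.
  by move=> ->; apply: leq_trans (lenM _ _) _; rewrite leq_add2l len_le.
(* If [r] shortened [v], moving it from [v] into [d] would give a longer dihedral factor. *)
have vr r : r \in [:: s; t] -> (len v <= len (v * cox_gen M r))%N.
  move=> rst; rewrite leqNgt; apply/negP => vr.
  suff /nmax : P n.+1 by rewrite ltnn.
  apply/asboolP; exists (v * cox_gen M r), (r :: d).
  by split; [exact/andP|rewrite /= dn|rewrite cox_prod_cons mulgA cox_genK|lia].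
(* A repeated letter in [d] would give a word for [w] shorter than [len w], and a final [s] would
   make w s shorter than w. *)
have dE : d = alt s t n.
  rewrite -dn; apply: alternating_alt => // [d1 d2 r de|d1 de].
    have /short : w = v * cox_prod (d1 ++ d2).
      by rewrite wE de !cox_prod_cat !cox_prod_cons [cox_gen M r * _]mulgA cox_gen2 mul1g.
    by move: dn; rewrite de !size_cat /=; lia.
  have /short : w * cox_gen M s = v * cox_prod d1.
    by rewrite wE de cox_prod_rcons mulgA cox_genK.
  by move: dn; rewrite de size_rcons; lia.
exists v, t, n.-1; rewrite prednK // -dE; split => //.
- lia.
- by split; apply: vr; rewrite !inE eqxx ?orbT.
(* If m <= n, a braid relation makes [d] end in [s], and again w s would be shorter than w. *)
move=> m stm; rewrite ltnNge; apply/negP => mn.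
have m2 := cox_off st stm.
have [e en eE] := alt_addn s t (n - m) m.
have /short : w * cox_gen M s = v * cox_prod (e ++ alt s t m.-1).
  rewrite wE dE -(subnK mn) eE !cox_prod_cat -[cox_prod (alt s t m)](cox_gen_braid st stm).
  by rewrite -/(cox_prod _) -{1}(prednK (ltnW m2)) alt_rcons cox_prod_rcons !mulgA cox_genK.
have salt x y j : size (alt x y j : seq S) = j by elim: j => //= j ->.
rewrite size_cat en salt; lia.
Qed.

End Length.

(** * Positivity of roots and the elements zeta *)

Section Roots.
Variables (R : realType) (S : finType) (M : coxeter_matrix S).
Notation W := (coxeter_group M).
Notation V := (rootV R S).
Implicit Types (s t r : S) (v w : W).

Lemma iotaW1 : iotaW (1 : W) = 1.
Proof. by apply: (mulgI (iotaW (1 : W))); rewrite -iotaWM !mulg1. Qed.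

Lemma iotaWV w : iotaW w^-1 = (iotaW w)^-1.
Proof. by apply: (mulgI (iotaW w)); rewrite -iotaWM !mulgV iotaW1. Qed.

Lemma iotaW_prod (u : seq S) : iotaW (cox_prod M u) = \prod_(s <- u) tau M s.
Proof.
elim: u => [|s u IH]; first by rewrite /cox_prod !big_nil iotaW1.
by rewrite cox_prod_cons iotaWM IH iotaW_gen big_cons.
Qed.

Lemma iotaW_prod_cls (u : seq S) :
  iotaW (cox_prod M u) = pcls (va_rel M) (gword (map (@tau_letter S) u)).
Proof.
rewrite iotaW_prod; elim: u => [|s u IH]; first by rewrite big_nil.
by rewrite big_cons IH /tau /pgen -pclsM.
Qed.

Lemma iotaWK w : Defs.piP (iotaW w) = w.
Proof.
have [u <-] := cox_prod_surj w; rewrite iotaW_prod.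
elim: u => [|s u IH]; first by rewrite /cox_prod !big_nil piP1.
by rewrite big_cons piPM piP_tau IH cox_prod_cons.
Qed.

Lemma mixed_sigma s t m (p := cox_prod M (alt s t m.-1))
    (r := if odd m then t else s) : s != t -> M s t = Some m ->
  iotaW p * sigma M s = sigma M r * iotaW p.
Proof.
move=> st stm; rewrite /p iotaW_prod_cls /sigma /pgen -!pclsM; apply/pclsP.
rewrite map_alt; apply: pres_rel.
by have := va_mixed st stm; rewrite /gword map_cat.
Qed.

(** The mixed relation carries sigma_s to sigma_r; its image under [piP], lifted back by [iotaW],
    does the same for tau. *)
Lemma mixed_zeta s t m (p := cox_prod M (alt s t m.-1))
    (r := if odd m then t else s) : s != t -> M s t = Some m ->
  iotaW p * (tau M s * sigma M s) * (iotaW p)^-1 = tau M r * sigma M r.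
Proof.
move=> st stm; have sE := mixed_sigma st stm.
have /(congr1 (@iotaW _ M)) := congr1 (@Defs.piP _ M) sE.
rewrite !piPM !iotaWK !piP_sigma !iotaWM !iotaW_gen mulgA => ->.
by rewrite -(mulgA (tau M r)) sE mulgA mulgK.
Qed.

Local Open Scope ring_scope.

Lemma comb2E (p q : R) s t r :
  comb2 p q s t r = p * (r == s)%:R + q * (r == t)%:R.
Proof. by rewrite !ffunE /= !scalerE. Qed.

Lemma rho_comb2E w (p q : R) s t r :
  rho w (comb2 p q s t) r = p * rho w (alpha R s) r + q * rho w (alpha R t) r.
Proof.
have rho0 : rho w (0 : {ffun S -> R}) = 0 :> {ffun S -> R}.
  by have := rho_linear w (-1) (0 : {ffun S -> R}) 0; rewrite scaler0 addr0 scaleN1r addNr.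
have := rho_linear w q (alpha R t) 0; rewrite rho0 !addr0 => qE.
by rewrite /comb2 rho_linear qE !ffunE /= !scalerE.
Qed.

Lemma alpha_inj : injective (alpha R : S -> _).
Proof.
move=> s t /ffunP/(_ s); rewrite !ffunE eqxx.
by case: eqP => // _ /eqP; rewrite oner_eq0.
Qed.

Lemma comb2_inj (p q p' q' : R) s t : s != t ->
  comb2 p q s t = comb2 p' q' s t -> p = p' /\ q = q'.
Proof.
move=> st /ffunP e; have := e s; have := e t.
by rewrite !comb2E !eqxx eq_sym (negPf st) !(mulr0, mulr1) !add0r !addr0.
Qed.

Lemma cheb_form_ge0 s t k (c := - cox_form R M s t) : s != t ->
    (forall m, M s t = Some m -> (k <= m)%N) ->
  0 <= (cheb c k).1.
Proof.
move=> st km; rewrite /c /cox_form; case E: (M s t) => [m|]; last first.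
  by rewrite opprK cheb2.
have m2 := cox_off st E.
rewrite mulNr opprK; have := km _ E; rewrite leq_eqVlt => /orP[/eqP ->|{}km].
  by rewrite (cheb_sym R m2 (addn0 m)).
case: k km => // k km; by apply/ltW/cheb_gt0.
Qed.

Lemma cheb_form_gt0 s t k (c := - cox_form R M s t) : s != t -> (0 < k)%N ->
    (forall m, M s t = Some m -> (k < m)%N) ->
  0 < (cheb c k).1.
Proof.
move=> st k0 km; rewrite /c /cox_form; case E: (M s t) => [m|]; last first.
  by rewrite opprK cheb2 ltr0n.
have m2 := cox_off st E.
by rewrite mulNr opprK cheb_gt0 // k0 km.
Qed.

(* Otherwise both roots would be multiples of alpha_r, against independence. *)
Lemma comb2_nonsimple v (p q : R) s t r : s != t -> 0 < p -> 0 < q ->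
    (forall x, 0 <= rho v (alpha R s) x) -> (forall x, 0 <= rho v (alpha R t) x) ->
  rho v (comb2 p q s t) <> alpha R r.
Proof.
move=> st p0 q0.
set x := rho v (alpha R s); set y := rho v (alpha R t) => x0 y0 e.
have z0 z : z != r -> x z = 0 /\ y z = 0.
  move=> zr; have : p * x z + q * y z = 0.
    by rewrite -rho_comb2E e ffunE (negPf zr).
  move/eqP; rewrite paddr_eq0 ?mulr_ge0 ?(ltW p0) ?(ltW q0) //.
  rewrite !mulf_eq0 (gt_eqF p0) (gt_eqF q0) /=.
  by case/andP => /eqP -> /eqP ->.
have inj (a b : R) : (forall z, a * x z + b * y z = 0) -> a = 0 /\ b = 0.
  move=> ab0; apply: (comb2_inj st); apply: (can_inj (rhoK v)).
  by apply/ffunP => z; rewrite !rho_comb2E ab0 !mul0r addr0.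
(* The combination (y r) x - (x r) y vanishes everywhere, so independence forces x r = 0, and then x
   = 0. *)
have [_ /eqP] : y r = 0 /\ - x r = 0.
  apply: inj => z; have [->|/z0[-> ->]] := eqVneq z r.
    by rewrite mulrC mulNr subrr.
  by rewrite !mulr0 addr0.
rewrite oppr_eq0 => /eqP xr.
have [] : 1 = 0 :> R /\ 0 = 0 :> R.
  apply: inj => z; rewrite mul0r addr0 mul1r.
  by have [->|/z0[]] := eqVneq z r.
by move=> /eqP; rewrite oner_eq0.
Qed.

(** For x = pi / m, sin (m x) = 0 and sin ((m - 1) x) = sin x, so one coordinate of the image is 0
    and the other 1. *)
Lemma rho_mixed_alpha s t m : s != t -> M s t = Some m ->
  rho (cox_prod M (alt s t m.-1)) (alpha R s) = alpha R (if odd m then t else s).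
Proof.
move=> st stm; have m2 := cox_off st stm.
rewrite rho_prod alt_reflections_alpha prednK 1?ltnW // /cox_form stm mulNr opprK.
rewrite (cheb_sym R m2 (addn0 m)) (@cheb_sym R m m2 m.-1 1) ?addn1 ?prednK 1?ltnW //=.
rewrite -[in RHS](prednK (ltnW m2)) /=; case: (odd m.-1);
  by rewrite /comb2 /= scale1r scale0r ?add0r ?addr0.
Qed.

(** Both claims share one induction on length: nonnegativity at the shorter [v] ensures that w
    alpha_s is simple only in the case of a mixed relation. *)
Lemma rho_alpha_ascent w s : (len w <= len (w * cox_gen M s)%g)%N ->
  (forall x, 0 <= rho w (alpha R s) x) /\
  (forall r, rho w (alpha R s) = alpha R r ->
     iotaW w * (tau M s * sigma M s) * (iotaW w)^-1 = tau M r * sigma M r)%g.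
Proof.
have [n] := ubnP (len w); elim: n => // n IH in w s *; rewrite ltnS => wn ws.
have [->|/eqP w1] := eqVneq w 1%g.
  rewrite rho1; split=> [x|r /alpha_inj <-]; first by rewrite ffunE ler0n.
  by rewrite iotaW1 invg1 mul1g mulg1.
have [v [t [k [st wE vw [vs vt] km]]]] := dihedral_factor w1 ws.
have [vs0 vsz] := IH v s (leq_trans vw wn) vs.
have [vt0 vtz] := IH v t (leq_trans vw wn) vt.
set U := fun n => (cheb (- cox_form R M s t) n).1.
pose p := if odd k.+1 then U k.+1 else U k.+2.
pose q := if odd k.+1 then U k.+2 else U k.+1.
have wa : rho w (alpha R s) = rho v (comb2 p q s t).
  by rewrite wE rhoM rho_prod alt_reflections_alpha /p /q; case: ifP.
(* As k + 1 < m, both indices are at most m, where the sine quotients are nonnegative. *)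
have U1 : 0 <= U k.+1 by apply: cheb_form_ge0 => // m /km /ltnW.
have U2 : 0 <= U k.+2 by apply: cheb_form_ge0.
split=> [x|r].
  rewrite wa rho_comb2E addr_ge0 // mulr_ge0 //.
    by rewrite /p; case: ifP.
  by rewrite /q; case: ifP.
(* Unless m = k + 2, both coefficients are positive and the image cannot be simple. *)
rewrite wa; have [stk|stk] := eqVneq (M s t) (Some k.+2); last first.
  move=> e; exfalso; move: e; apply: comb2_nonsimple => //.
    rewrite /p; case: ifP => _; apply: cheb_form_gt0 => // m E; have := km m E => //.
    by rewrite leq_eqVlt => /orP[/eqP mk|//]; rewrite E -mk eqxx in stk.
  rewrite /q; case: ifP => _; apply: cheb_form_gt0 => // m E; have := km m E => //.
  by rewrite leq_eqVlt => /orP[/eqP mk|//]; rewrite E -mk eqxx in stk.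
(* For m = k + 2 the alternating word is that of the mixed relation, and the claim passes to [v]
   with [s] or [t]. *)
have -> : rho v (comb2 p q s t) = rho v (alpha R (if odd k.+2 then t else s)).
  by rewrite -wa wE rhoM (rho_mixed_alpha st stk).
move=> e; have <- : (iotaW v * (tau M (if odd k.+2 then t else s) *
    sigma M (if odd k.+2 then t else s)) * (iotaW v)^-1 = tau M r * sigma M r)%g.
  by move: e; case: ifP => _ e; [apply: vtz|apply: vsz].
by rewrite wE iotaWM -(mixed_zeta st stk) invgM !mulgA.
Qed.

(** If [s] shortens [w], then w s is covered by the ascent lemma but sends alpha_s to -alpha_r,
    against nonnegativity. *)
Lemma rho_simple_zeta w s r : rho w (alpha R s) = alpha R r ->
  (iotaW w * (tau M s * sigma M s) * (iotaW w)^-1 = tau M r * sigma M r)%g.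
Proof.
have [/rho_alpha_ascent[_]|] := leqP (len w) (len (w * cox_gen M s)%g); first exact.
rewrite -{2}(cox_genK s w) => /ltnW/rho_alpha_ascent[/(_ r) + _] e.
have -> : rho (w * cox_gen M s)%g (alpha R s) = rho w (comb2 (-1) 0 s s).
  rewrite rhoM rho_gen bform_alpha cox_form_diag; congr rho.
  by apply/ffunP => z; rewrite comb2E !ffunE /= !scalerE; ring.
by rewrite rho_comb2E e ffunE eqxx mulr1 mul0r addr0 oppr_ge0 ler10.
Qed.

Local Open Scope group_scope.

(** The pair (v, t) picked inside [zeta] satisfies v^-1 w alpha_s = alpha_t, so [rho_simple_zeta]
    makes the value independent of the choice. *)
Lemma zetaE w s :
  zeta M (rho w (alpha R s)) = iotaW w * (tau M s * sigma M s) * (iotaW w)^-1.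
Proof.
rewrite /zeta; case: pselect => [bP|]; last by case; exists (w, s).
case: (cid bP) => -[v t] /= e.
have /rho_simple_zeta <- : rho (v^-1 * w) (alpha R s) = alpha R t.
  by rewrite rhoM e rhoK.
by rewrite iotaWM iotaWV invgM invgK !mulgA mulgV mul1g mulgK.
Qed.

Lemma Phi_rho w (b : V) : Phi R M b -> Phi R M (rho w b).
Proof. by move=> [v [s ->]]; exists (w * v), s; rewrite rhoM. Qed.

Lemma Phi_alpha s : Phi R M (alpha R s).
Proof. by exists 1, s; rewrite rho1. Qed.

Lemma zeta_rho w (b : V) : Phi R M b ->
  zeta M (rho w b) = iotaW w * zeta M b * (iotaW w)^-1.
Proof. by move=> [v [s ->]]; rewrite -rhoM !zetaE iotaWM invgM !mulgA. Qed.

Lemma zeta_PVA (b : V) : PVA (zeta M b).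
Proof.
rewrite /PVA /=; have [[v [s ->]]|nb] := pselect (Phi R M b).
  by rewrite zetaE !piPM piPV iotaWK piP_tau piP_sigma cox_gen2 mulg1 mulgV.
rewrite /zeta; case: pselect => [bP|_]; last exact: piP1.
by case: nb; case: bP => -[v s] ->; exists v, s.
Qed.

Lemma Phi_finite : spherical M -> finite_set (Phi R M).
Proof.
move=> fW.
have -> : Phi R M = [set rho ws.1 (alpha R ws.2) | ws in setX [set: W] [set: S]]%classic.
  by apply/seteqP; split=> [b [v [s ->]]|b [[v s] _ <-]]; [exists (v, s)|exists v, s].
by apply: finite_image; apply: finite_setX.
Qed.

End Roots.

(** * Coefficients of elements of VA/PVA' *)

Section SemidirectProduct.
Variables (R : realType) (S : finType) (M : coxeter_matrix S).
Notation W := (coxeter_group M).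
Notation V := (rootV R S).

(* The pair (w, f) stands for w * f, so that f is acted upon from the right by
   precomposition with rho. *)
Definition sdprod : Type := (W * (V -> int))%type.
HB.instance Definition _ := Choice.on sdprod.

Definition sd_mul (x y : sdprod) : sdprod := (x.1 * y.1, fun b => (x.2 (rho y.1 b) + y.2 b)%R).
Definition sd_one : sdprod := (1, fun=> 0%R).
Definition sd_inv (x : sdprod) : sdprod := (x.1^-1, fun b => (- x.2 (rho x.1^-1%g b))%R).

Lemma sd_mulA : associative sd_mul.
Proof.
move=> x y z; congr pair => /=; first exact: mulgA.
by apply/funext => b; rewrite rhoM addrA.
Qed.

Lemma sd_mul1 : left_id sd_one sd_mul.
Proof.
case=> w f; congr pair => /=; first exact: mul1g.
by apply/funext => b; rewrite add0r.
Qed.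

Lemma sd_mulg1 : right_id sd_one sd_mul.
Proof.
case=> w f; congr pair => /=; first exact: mulg1.
by apply/funext => b; rewrite rho1 addr0.
Qed.

Lemma sd_mulVg : left_inverse sd_one sd_inv sd_mul.
Proof.
case=> w f; congr pair => /=; first exact: mulVg.
by apply/funext => b; rewrite rhoK addNr.
Qed.

Lemma sd_mulgV : right_inverse sd_one sd_inv sd_mul.
Proof.
case=> w f; congr pair => /=; first exact: mulgV.
by apply/funext => b; rewrite addrN.
Qed.

HB.instance Definition _ :=
  isGroup.Build sdprod sd_mulA sd_mul1 sd_mulg1 sd_mulVg sd_mulgV.

(* The coefficients a of the unique writing prod_b zeta_b^(a b) * w. *)
Definition lcoef (x : sdprod) (b : V) : int := x.2 (rho x.1^-1 b).

Lemma lcoefM (x y : sdprod) b : lcoef (x * y) b = (lcoef x b + lcoef y (rho x.1^-1%g b))%R.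
Proof. by rewrite /lcoef /= invgM !rhoM -(rhoM y.1) mulgV rho1. Qed.

Lemma lcoefV (x : sdprod) b : lcoef x^-1%g b = (- lcoef x (rho x.1 b))%R.
Proof. by rewrite /lcoef /= invgK !rhoK. Qed.

Lemma lcoef_conj_trans (x y : sdprod) b : y.1 = 1 ->
  lcoef (x * y * x^-1) b = lcoef y (rho x.1^-1 b).
Proof.
move=> y1; rewrite !lcoefM lcoefV /= y1 mulg1 -rhoM mulgV rho1.
by rewrite addrAC addrN add0r.
Qed.

(** This is the origin of the coboundary term in the conjugacy criterion. *)
Lemma lcoef_trans_conj (x y : sdprod) b : x.1 = 1 ->
  lcoef (x * y * x^-1) b = (lcoef x b + lcoef y b - lcoef x (rho y.1^-1%g b))%R.
Proof. by move=> x1; rewrite !lcoefM lcoefV /= x1 mul1g invg1 !rho1. Qed.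

Definition sd_delta (b : V) : sdprod := (1, fun c : V => (c == b)%:R%R).

(** With this choice tau_s sigma_s becomes the delta function at alpha_s, with trivial part in
    [W]. *)
Definition sd_gen (l : S + S) : sdprod :=
  match l with
  | inl s => (cox_gen M s, fun c : V => (c == alpha R s)%:R%R)
  | inr s => (cox_gen M s, fun=> 0%R)
  end.

Lemma sd_tau_prod u :
  \prod_(l <- map (@tau_letter S) u) sd_gen l = (cox_prod M u, fun=> 0%R).
Proof.
elim: u => [|s u IH]; first by rewrite /cox_prod !big_nil.
by rewrite /= big_cons IH cox_prod_cons.
Qed.

(** A new letter on the left contributes the delta function at the preimage of its simple root under
    the rest of the word, which is the next inversion root. *)
Lemma sd_sigma_alt s t m :
  \prod_(l <- alt (@sig_letter S t) (sig_letter s) m) sd_gen l =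
  (cox_prod M (alt t s m),
   fun c : V => (\sum_(i < m) (c == comb2 (cheb (- cox_form R M s t) i.+1).1
                                 (cheb (- cox_form R M s t) i).1 s t)%:R)%R).
Proof.
elim: m => [|m IH].
  rewrite /cox_prod !big_nil; congr pair.
  by apply/funext => c; rewrite big_ord0.
rewrite [alt t s m.+1]/= [alt _ _ m.+1]/= big_cons cox_prod_cons IH.
rewrite (_ : (if _ then _ else _) = sig_letter (if odd m then t else s)); last first.
  by case: ifP.
congr pair => /=; apply/funext => c; rewrite big_ord_recr addrC /=; congr (_ + _)%R.
rewrite -(alt_reflections_root R M s t m) -rho_prod.
by rewrite (can_eq (rhoK _)).
Qed.

Lemma sd_rels u v : va_rel M u v -> wval sd_gen u = wval sd_gen v.
Proof.
case=> [s t m st stm|s t m st stm|s|s t m st stm]; rewrite !wval_gword.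
- have m2 := cox_off st stm; rewrite !sd_sigma_alt; congr pair.
    exact: cox_gen_braid.
  (* The two words have the same inversion roots in opposite orders, by the symmetry of the sine
     quotients. *)
  apply/funext => c; rewrite [RHS](reindex_inj rev_ord_inj) /=.
  apply: eq_bigr => i _; rewrite comb2C !(cox_formC R M t s) /cox_form stm mulNr opprK.
  rewrite (@cheb_sym R m m2 (m - i.+1).+1 i) ?(@cheb_sym R m m2 (m - i.+1) i.+1) //;
    have := ltn_ord i; lia.
- rewrite -!map_alt !sd_tau_prod; congr pair; exact: cox_gen_braid.
- rewrite -[[:: _; _]]/(map (@tau_letter S) [:: s; s]) sd_tau_prod big_nil.
  by rewrite !cox_prod_cons /cox_prod !big_nil mulg1 cox_gen2.
(* The delta functions of the two sigma letters match because the tau word carries one simple root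
   to the other. *)
- rewrite big_cat big_seq1 big_cons -map_alt !sd_tau_prod.
  have := congr1 (@Defs.piP _ M) (mixed_sigma st stm).
  rewrite !piPM !piP_sigma !iotaWK => pE; congr pair => //.
  apply/funext => c /=; rewrite add0r addr0.
  by rewrite -(rho_mixed_alpha R st stm) (can_eq (rhoK _)).
Qed.

Definition sd_map : virtual_artin M -> sdprod := plift sd_gen.

Lemma sd_mapM : {morph sd_map : x y / x * y}.
Proof. exact: (pliftM sd_rels). Qed.

Lemma sd_map1 : sd_map 1 = 1.
Proof. by apply: (mulgI (sd_map 1)); rewrite -sd_mapM !mulg1. Qed.

Lemma sd_mapV x : sd_map x^-1 = (sd_map x)^-1.
Proof. by apply: (mulgI (sd_map x)); rewrite -sd_mapM !mulgV sd_map1. Qed.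

Lemma sd_map_tau s : sd_map (tau M s) = (cox_gen M s, fun=> 0%R).
Proof. exact: (plift_gen sd_rels). Qed.

Lemma sd_map_sigma s :
  sd_map (sigma M s) = (cox_gen M s, fun c : V => (c == alpha R s)%:R%R).
Proof. exact: (plift_gen sd_rels). Qed.

Lemma virtual_artin_ind (P : virtual_artin M -> Prop) :
    P 1 -> (forall x y, P x -> P y -> P (x * y)) -> (forall x, P x -> P x^-1) ->
    (forall s, P (sigma M s)) -> (forall s, P (tau M s)) ->
  forall x, P x.
Proof.
move=> P1 PM PV Ps Pt x; rewrite -(pcls_repr x).
elim: (repr x) => [|l u IH]; first exact: P1.
rewrite -cat1s pclsM; apply: PM => //.
have Pl k : P (pgen (va_rel M) k) by case: k => s; [exact: Ps|exact: Pt].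
case: l => k [] /=; last exact: Pl.
have <- : (pgen (va_rel M) k)^-1 = pcls (va_rel M) [:: (k, true)] by exact: pinv_cls.
exact/PV/Pl.
Qed.

Lemma sd_map_piP x : (sd_map x).1 = Defs.piP x.
Proof.
elim/virtual_artin_ind: x => [|x y IHx IHy|x IH|s|s].
- by rewrite sd_map1 piP1.
- by rewrite sd_mapM piPM /= IHx IHy.
- by rewrite sd_mapV piPV /= IH.
- by rewrite sd_map_sigma piP_sigma.
- by rewrite sd_map_tau piP_tau.
Qed.

Lemma sd_map_iotaW w : sd_map (iotaW w) = (w, fun=> 0%R).
Proof.
have [u <-] := cox_prod_surj w; rewrite iotaW_prod.
elim: u => [|s u IH]; first by rewrite /cox_prod !big_nil sd_map1.
by rewrite big_cons sd_mapM IH sd_map_tau cox_prod_cons.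
Qed.

Lemma sd_map_zeta b : Phi R M b -> sd_map (zeta M b) = sd_delta b.
Proof.
move=> [w [s ->]]; rewrite zetaE !sd_mapM sd_mapV sd_map_iotaW sd_map_tau sd_map_sigma.
congr pair => /=; first by rewrite cox_gen2 mulg1 mulgV.
apply/funext => c; rewrite !add0r oppr0 addr0.
by rewrite -[in LHS](rhoK w (alpha R s)) (can_eq (rhoK _)).
Qed.

Lemma zeta_inj b c : Phi R M b -> Phi R M c -> zeta M b = zeta M c -> b = c.
Proof.
move=> Pb Pc /(congr1 sd_map); rewrite !sd_map_zeta // => -[/(congr1 (@^~ b))].
by rewrite eqxx; case: eqP.
Qed.

Lemma PVA_commute_sd x y : PVA x -> PVA y -> sd_map (x * y) = sd_map (y * x).
Proof.
rewrite /PVA /= -!sd_map_piP !sd_mapM => x1 y1; congr pair => /=.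
  by rewrite x1 y1.
by apply/funext => b; rewrite x1 y1 !rho1 addrC.
Qed.

(** The kernel [PVA] lands in the abelian group of integer functions, so its commutators die and
    [sd_map] descends to the quotient. *)
Lemma sd_map_PVA' x : PVA' x -> sd_map x = 1.
Proof.
move/(_ [set z | sd_map z = 1]%classic); apply.
  split=> /= [|y z|y]; first exact: sd_map1.
    by rewrite sd_mapM => -> ->; rewrite mulg1.
  by rewrite sd_mapV => ->; rewrite invg1.
move=> _ [y [z [Py Pz ->]]] /=; apply: (mulgI (sd_map (z * y))).
by rewrite -sd_mapM -commgC mulg1; exact: PVA_commute_sd.
Qed.

Definition sdbar (x : VA_mod_PVA' M) : sdprod := sd_map (repr x).

Lemma sdbar_cls x : sdbar (cls x) = sd_map x.
Proof.
have /qclsP/sd_map_PVA' : cls (repr (cls x)) = cls x by exact: qcls_repr.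
rewrite sd_mapM sd_mapV => e.
by rewrite -[RHS](mulVKg (sd_map (repr (cls x)))) e mulg1.
Qed.

Lemma cls_surj (x : VA_mod_PVA' M) : exists y, cls y = x.
Proof. by exists (repr x); exact: qcls_repr. Qed.

Lemma sdbarM : {morph sdbar : x y / x * y}.
Proof.
move=> x y; have [{}x <-] := cls_surj x; have [{}y <-] := cls_surj y.
by rewrite -clsM !sdbar_cls sd_mapM.
Qed.

Lemma sdbar1 : sdbar 1 = 1.
Proof. by apply: (mulgI (sdbar 1)); rewrite -sdbarM !mulg1. Qed.

Lemma sdbarV x : sdbar x^-1 = (sdbar x)^-1.
Proof. by apply: (mulgI (sdbar x)); rewrite -sdbarM !mulgV sdbar1. Qed.

Lemma sdbar_piPbar x : (sdbar x).1 = piPbar x.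
Proof. exact: sd_map_piP. Qed.

Lemma piPbarM : {morph @piPbar _ M : x y / x * y}.
Proof.
move=> x y; have [{}x <-] := cls_surj x; have [{}y <-] := cls_surj y.
by rewrite -clsM !piPbar_cls piPM.
Qed.

Lemma piPbarV x : piPbar x^-1 = (piPbar x)^-1 :> W.
Proof.
have [{}x <-] := cls_surj x; apply: (mulgI (piPbar (cls x))).
have <- := piPbarM (cls x) (cls x)^-1.
by rewrite !mulgV -(piP1 M) -piPbar_cls.
Qed.

Lemma sdbar_clsW w : sdbar (clsW w) = (w, fun=> 0%R).
Proof. by rewrite sdbar_cls sd_map_iotaW. Qed.

Lemma piPbar_clsW (w : W) : piPbar (clsW w) = w.
Proof. by rewrite piPbar_cls iotaWK. Qed.

End SemidirectProduct.

(** * Normal form of the elements of VA/PVA' *)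

Lemma zpowD (G : groupType) (x : G) m n : zpow x (m + n)%R = zpow x m * zpow x n.
Proof.
have zpowS k : zpow x (k + 1)%R = zpow x k * x.
  case: k => [k|[|k]].
  - by rewrite -PoszD addn1 /= expgSr.
  - by rewrite /= mulVg.
  - have -> : (Negz k.+1 + 1)%R = Negz k by lia.
    by rewrite /= [x ^+ k.+2]expgS invgM mulgVK.
elim/int_rect: n => [|n IH|n IH].
- by rewrite addr0 mulg1.
- by rewrite -addn1 PoszD addrA !zpowS IH mulgA.
- apply: (mulIg x); rewrite -mulgA -!zpowS -addrA.
  by have -> : (- Posz n.+1 + 1 = - Posz n)%R by lia.
Qed.

Section ZetaProducts.
Variables (R : realType) (S : finType) (M : coxeter_matrix S).
Notation W := (coxeter_group M).
Notation V := (rootV R S).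
Notation VAab := (VA_mod_PVA' M).

Lemma cls_PVA_commute x y : PVA x -> PVA y -> commute (cls x : VAab) (cls y).
Proof.
move=> Px Py; rewrite /commute -!clsM; apply/qclsP => H [_ _ HV] H' .
rewrite -[_^-1 * _]invgK; apply: HV; apply: H'; exists x, y; split=> //.
by rewrite invgM invgK /commg /conjg !invgM !mulgA.
Qed.

Lemma commuteZpow (G : groupType) (x y : G) m n :
  commute x y -> commute (zpow x m) (zpow y n).
Proof.
move=> xy; case: m n => m [] n /=; rewrite -?expVgn; apply: commuteX2 => //.
- exact: commuteV.
- exact/commute_sym/commuteV/commute_sym.
- exact/commuteV/commute_sym/commuteV/commute_sym.
Qed.

Lemma zetabar_zpow_commute (b c : V) m n :
  commute (zpow (zetabar M b) m) (zpow (zetabar M c) n).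
Proof. by apply: commuteZpow; apply: cls_PVA_commute; exact: zeta_PVA. Qed.

Lemma zeta_prodM (f g : V -> int) :
  zeta_prod M (fun b => f b + g b)%R = zeta_prod M f * zeta_prod M g.
Proof.
rewrite /zeta_prod -prodgM_commute; first by apply: eq_bigr => b _; rewrite zpowD.
by move=> b c _ _; exact: zetabar_zpow_commute.
Qed.

Lemma sdbar_zpow (x : VAab) (f : V -> int) k : sdbar R x = (1, f) ->
  sdbar R (zpow x k) = (1, fun b => (k * f b)%R).
Proof.
move=> xf; have sdX n : sdbar R (x ^+ n) = (1, fun b => (Posz n * f b)%R).
  elim: n => [|n IH]; first by rewrite sdbar1; congr pair; apply/funext => b; rewrite mul0r.
  rewrite expgS sdbarM IH xf; congr pair => /=; first exact: mul1g.
  by apply/funext => b; rewrite rho1 -add1n PoszD mulrDl mul1r.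
case: k => n /=; first exact: sdX.
rewrite sdbarV sdX; congr pair => /=; first exact: invg1.
by apply/funext => b; rewrite invg1 rho1 NegzE mulNr.
Qed.

Hypothesis M_spherical : spherical M.

Lemma mem_Phi b : b \in fset_set (Phi R M) <-> Phi R M b.
Proof.
have fP := Phi_finite R M_spherical; rewrite in_fset_set //.
by split=> [/set_mem|/mem_set].
Qed.

Lemma sdbar_prod (s : seq V) (f : V -> int) : (forall b, b \in s -> Phi R M b) ->
  sdbar R (\prod_(b <- s) zpow (zetabar M b) (f b)) =
  (1, fun c : V => (\sum_(b <- s) f b * (c == b)%:R)%R).
Proof.
elim: s => [|b s IH] sP.
  by rewrite big_nil sdbar1; congr pair; apply/funext => c; rewrite big_nil.
rewrite big_cons sdbarM IH; last by move=> c cs; apply: sP; rewrite inE cs orbT.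
rewrite (@sdbar_zpow _ (fun c : V => (c == b)%:R%R)); last first.
  by rewrite sdbar_cls sd_map_zeta //; apply: sP; rewrite inE eqxx.
congr pair => /=; first exact: mul1g.
by apply/funext => c; rewrite rho1 big_cons.
Qed.

Lemma piPbar_zeta_prod (f : V -> int) : piPbar (zeta_prod M f) = 1.
Proof. by rewrite -(sdbar_piPbar R) sdbar_prod // => b /mem_Phi. Qed.

(** The delta functions isolate each exponent, which gives uniqueness of the exponents on roots. *)
Lemma lcoef_zeta_prod (f : V -> int) b : Phi R M b ->
  lcoef (sdbar R (zeta_prod M f)) b = f b.
Proof.
move=> Pb; rewrite /lcoef sdbar_prod /= => [|c /mem_Phi //].
rewrite invg1 rho1 (bigD1_seq b) ?fset_uniq //=; last exact/mem_Phi.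
by rewrite eqxx mulr1 big1 ?addr0 // => c /negPf cb; rewrite eq_sym cb mulr0.
Qed.

Lemma lcoef_zeta_prod_clsW (f : V -> int) (w : W) b : Phi R M b ->
  lcoef (sdbar R (zeta_prod M f * clsW w)) b = f b.
Proof.
move=> Pb; rewrite sdbarM lcoefM lcoef_zeta_prod // sdbar_clsW.
by rewrite /lcoef /= addr0.
Qed.

Lemma zeta_prod_zpow b k : Phi R M b ->
  exists f : V -> int, zpow (zetabar M b) k = zeta_prod M f.
Proof.
move=> /mem_Phi Pb; exists (fun c => if c == b then k else 0%R).
have {Pb} : b \in enum_fset (fset_set (Phi R M)) by [].
rewrite /zeta_prod; elim: (enum_fset _) (fset_uniq (fset_set (Phi R M))) => // c s IH /=.
rewrite inE big_cons => /andP[cs us] /orP[/eqP bc|bs]; first rewrite -bc in cs *.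
  rewrite eqxx big_seq big1 ?mulg1 // => d ds.
  by rewrite ifN //; apply: contraNneq cs => <-.
rewrite ifN ?mul1g ?IH //.
by apply: contraNneq cs => ->.
Qed.

(** Commuting classes can be collected in any order and with repetitions, so conjugation by [W] is
    handled without reindexing the roots. *)
Lemma zeta_prod_seq (s : seq V) (g : V -> V) (f : V -> int) :
    (forall b, b \in s -> Phi R M (g b)) ->
  exists h : V -> int,
    \prod_(b <- s) zpow (zetabar M (g b)) (f b) = zeta_prod M h.
Proof.
elim: s => [|b s IH] sP.
  by exists (fun=> 0%R); rewrite big_nil /zeta_prod big1.
have [h hE] := IH (fun c cs => sP c (mem_behead (s := b :: s) cs)).
have [k kE] := zeta_prod_zpow (f b) (sP b (mem_head _ _)).
by exists (fun c => k c + h c)%R; rewrite big_cons hE kE zeta_prodM.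
Qed.

Lemma zpowJ (G : groupType) (x y : G) k : zpow x k ^ y = zpow (x ^ y) k.
Proof. by case: k => k /=; rewrite ?conjVg conjXg. Qed.

Lemma zeta_prod_conj (f : V -> int) (w : W) :
  exists h : V -> int, zeta_prod M f ^ (clsW w) = zeta_prod M h.
Proof.
have [|h hE] := @zeta_prod_seq (fset_set (Phi R M)) (rho w^-1) f.
  by move=> b /mem_Phi; exact: Phi_rho.
exists h; rewrite -hE /zeta_prod conjg_prod big_seq [RHS]big_seq.
apply: eq_bigr => b /mem_Phi Pb; rewrite zpowJ; congr zpow.
rewrite /zetabar zeta_rho // iotaWV invgK !clsM conjgE mulgA; congr (_ * _ * _).
apply: (mulIg (clsW w)); by rewrite mulVg /clsW -clsM mulVg.
Qed.

Lemma zeta_prod_form (x : VAab) :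
  exists f : V -> int, x = zeta_prod M f * clsW (piPbar x).
Proof.
have clsW1 : clsW (1 : W) = 1.
  by apply: (mulgI (clsW (1 : W))); rewrite /clsW -clsM -iotaWM !mulg1.
have clsWM (w v : W) : clsW (w * v) = clsW w * clsW v.
  by rewrite /clsW iotaWM clsM.
have clsWV (w : W) : clsW w^-1 = (clsW w)^-1.
  by apply: (mulgI (clsW w)); rewrite -clsWM !mulgV clsW1.
have zeta_prod0 : zeta_prod M (fun _ : V => 0%R : int) = 1.
  by rewrite /zeta_prod big1.
(* Conjugation turns products of the classes into such products, so elements of [W] can be moved to
   the right. *)
have swap (f : V -> int) w : exists h : V -> int,
    clsW w * zeta_prod M f = zeta_prod M h * clsW w.
  have [h hE] := zeta_prod_conj f w^-1; exists h.
  by rewrite -hE conjgE clsWV invgK !mulgA mulgVK.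
have [{}x <-] := cls_surj x; rewrite piPbar_cls.
elim/virtual_artin_ind: x => [|x y [f fE] [g gE]|x [f fE]|s|s].
- by exists (fun=> 0%R); rewrite zeta_prod0 piP1 clsW1 mulg1.
- have [h hE] := swap g (Defs.piP x).
  exists (fun b => f b + h b)%R; rewrite clsM fE gE zeta_prodM piPM clsWM.
  by rewrite !mulgA -(mulgA (zeta_prod M f)) hE !mulgA.
- have [h hE] := swap (fun b => - f b)%R (Defs.piP x)^-1.
  exists h; rewrite piPV -hE; apply: (mulIg (cls x)).
  have -> : cls x^-1 * cls x = 1 :> VAab by rewrite -clsM mulVg.
  rewrite fE mulgA -(mulgA (clsW _)) -zeta_prodM.
  rewrite (_ : (fun b => _) = (fun=> 0%R)); last by apply/funext => b; rewrite addNr.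
  by rewrite zeta_prod0 mulg1 -clsWM mulVg clsW1.
(* As tau_s is an involution, sigma_s = tau_s (tau_s sigma_s), whose second factor is zeta at
   alpha_s. *)
- have [k kE] := zeta_prod_zpow 1 (Phi_alpha R M s).
  have [h hE] := swap k (cox_gen M s); exists h.
  rewrite piP_sigma -hE -kE /= expg1 /zetabar /clsW iotaW_gen -clsM.
  have := zetaE R (1 : W) s; rewrite rho1 iotaW1 invg1 mul1g mulg1 => ->.
  by rewrite mulgA -iotaW_gen -iotaWM cox_gen2 iotaW1 mul1g.
- by exists (fun=> 0%R); rewrite zeta_prod0 piP_tau /clsW iotaW_gen mul1g.
Qed.

(** Every element has a normal form and [lcoef] recovers its exponents, so equality in the quotient
    reduces to [W] and integers. *)
Lemma VAab_eq (x y : VAab) : piPbar x = piPbar y ->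
  (forall b, Phi R M b -> lcoef (sdbar R x) b = lcoef (sdbar R y) b) -> x = y.
Proof.
have [f fE] := zeta_prod_form x; have [g gE] := zeta_prod_form y.
rewrite fE gE !piPbarM !piPbar_zeta_prod !mul1g !piPbar_clsW => -> xy.
congr (_ * _); apply: eq_big_seq => b /mem_Phi Pb; congr zpow.
by have := xy b Pb; rewrite !lcoef_zeta_prod_clsW.
Qed.

End ZetaProducts.

(** * Orbit sums *)

Lemma inj_iter (T : Type) (f : T -> T) n : injective f -> injective (iter n f).
Proof. by move=> f_inj; elim: n => // n IH x y /f_inj/IH. Qed.

Section Period.
Variables (T : choiceType) (f : T -> T) (x : T).

Definition is_period p :=
  [/\ (0 < p)%N, iter p f x = x & forall j, (0 < j < p)%N -> iter j f x <> x].

Lemma iter_mod p k : iter p f x = x -> iter k f x = iter (k %% p) f x.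
Proof.
move=> px; rewrite [in LHS](divn_eq k p) addnC iterD; congr iter.
by elim: (k %/ p)%N => // q IH; rewrite mulSn iterD IH.
Qed.

Section Minimal.
Variable p : nat.
Hypothesis px : is_period p.

Lemma iter_traject k : iter k f x \in traject f x p.
Proof.
case: px => p0 pE _; rewrite (iter_mod k pE); apply/trajectP.
by exists (k %% p)%N; rewrite // ltn_mod.
Qed.

Hypothesis f_inj : injective f.

Lemma period_iter i j : iter i f x = iter j f x -> (i %% p = j %% p)%N.
Proof.
case: px => p0 pE pmin; rewrite (iter_mod i pE) (iter_mod j pE).
have := ltn_pmod i p0; have := ltn_pmod j p0.
move: (i %% p)%N (j %% p)%N => {}i {}j.
wlog ij : i j / (i <= j)%N => [H jp ip e|jp ip].
  by have [ij|/ltnW ji] := leqP i j; [exact: H|rewrite (H j i)].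
rewrite -{1}(subnKC ij) iterD => /(inj_iter f_inj) /esym e.
have [//|ij'] := eqVneq i j.
by case: (pmin (j - i)%N) => //; lia.
Qed.

Lemma period_uniq : uniq (traject f x p).
Proof.
case: px => p0 _ _; rewrite -(prednK p0) looping_uniq; apply/negP.
move=> /trajectP[i ip /period_iter]; rewrite !modn_small; lia.
Qed.

(* Partial sums along the orbit of x solve h (f y) - h y = k (f y) there; the
   hypothesis says that they only depend on the point reached. *)
Lemma period_sum (k : T -> int) i j :
    (\sum_(0 <= t < p) k (iter t f x) = 0)%R -> iter i f x = iter j f x ->
  (\sum_(0 <= t < i) k (iter t.+1 f x) = \sum_(0 <= t < j) k (iter t.+1 f x))%R.
Proof.
case: px => p0 pE _ k0 /period_iter ij.
(* Each full turn sums to zero; starting it one step late only rotates the cycle. *)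
have shift n : (\sum_(0 <= t < n) k (iter t.+1 f x) =
    \sum_(0 <= t < n %% p) k (iter t.+1 f x))%R.
  rewrite {1}(divn_eq n p); elim: (n %/ p)%N => // q IH.
  rewrite mulSn -addnA (big_cat_nat (n := p)) ?leq_addr //=.
  rewrite -{2}(add0n p) big_addn addKn -IH -[RHS]add0r; congr (_ + _)%R.
    apply: etrans k0; rewrite -(prednK p0) big_nat_recr // [RHS]big_nat_recl // addrC.
    by rewrite -[f (iter p.-1 _ _)]iterS prednK // pE.
  by apply: eq_bigr => t _; rewrite iterD pE.
by rewrite (shift i) (shift j) ij.
Qed.

End Minimal.

Lemma period_exists (s : seq T) : injective f -> (forall i, iter i f x \in s) ->
  exists p, is_period p.
Proof.
move=> f_inj xs.
have [p0 [p0_gt0 p0E]] : exists p, (0 < p)%N /\ iter p f x = x.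
  (* By pigeonhole, 1 + [size s] iterates inside [s] repeat; injectivity then brings the repetition
     back to [x]. *)
  have : looping f x (size s).
    apply: contraTT (leqnn (size s).+1); rewrite -looping_uniq => u.
    rewrite -leqNgt -(size_traject f x (size s).+1); apply: uniq_leq_size => //.
    by move=> _ /trajectP[i _ ->].
  move=> /trajectP[i i_lt]; rewrite -{1}(subnKC (ltnW i_lt)) iterD.
  by move=> /(inj_iter f_inj) e; exists (size s - i)%N; rewrite subn_gt0.
pose P p := (0 < p)%N && (iter p f x == x).
have exP : exists p, P p by exists p0; rewrite /P p0_gt0 p0E eqxx.
have [p /andP[p_gt0 /eqP pE] pmin] := ex_minnP exP.
exists p; split=> // j /andP[j0 jp] jx.
by have := pmin j; rewrite /P j0 jx eqxx leqNgt jp => /(_ isT).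
Qed.

End Period.

(** * Orbits of theta on the roots, and coboundaries *)

Section Orbits.
Variables (R : realType) (S : finType) (M : coxeter_matrix S).
Notation W := (coxeter_group M).
Notation V := (rootV R S).
Hypothesis M_spherical : spherical M.
Variable th : W.
Let F : V -> V := rho th.

Lemma rho_inj (w : W) : injective (@rho R S M w).
Proof. exact: can_inj (rhoK w). Qed.

Lemma rho_expg (w : W) n (b : V) : rho (w ^+ n) b = iter n (rho w) b.
Proof. by elim: n => [|n IH]; rewrite ?rho1 // expgS rhoM IH. Qed.

Lemma Phi_iter (w : W) n (b : V) : Phi R M b -> Phi R M (iter n (rho w) b).
Proof. by rewrite -rho_expg; exact: Phi_rho. Qed.

Lemma root_period b : Phi R M b -> exists p, is_period F b p.
Proof.
move=> Pb; apply: (@period_exists _ _ _ (fset_set (Phi R M))); first exact: rho_inj.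
by move=> i; have /(mem_Phi M_spherical) := Phi_iter th i Pb.
Qed.

Lemma zorbitE b p : is_period F b p ->
  zorbit th b = [set` [fset x in map (@zeta R S M) (traject F b p)]%fset]%classic.
Proof.
move=> pb; apply/seteqP; split=> x /=; last first.
  rewrite inE => /mapP[_ /trajectP[i _ ->] ->].
  by exists (th ^+ i); [exists (Posz i)|rewrite /= rho_expg].
move=> [_ [k _ <-] <-]; rewrite inE; apply: map_f.
case: k => n /=; first by rewrite rho_expg; exact: iter_traject.
have [p0 pE _] := pb.
(* A negative power is traded for a nonnegative one by adding n + 1 full periods. *)
have -> : rho (th ^- n.+1) b = iter (p * n.+1 - n.+1) F b.
  apply: (@rho_inj (th ^+ n.+1)); rewrite -rhoM mulgV rho1 rho_expg -iterD subnKC.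
    by rewrite (iter_mod _ pE) modnMr.
  by rewrite leq_pmull.
exact: iter_traject.
Qed.

Lemma zeta_traject_uniq b p : Phi R M b -> is_period F b p ->
  uniq (map (@zeta R S M) (traject F b p)).
Proof.
move=> Pb pb; rewrite map_inj_in_uniq; first exact/period_uniq/rho_inj.
move=> _ _ /trajectP[i _ ->] /trajectP[j _ ->]; apply: zeta_inj; exact: Phi_iter.
Qed.

Lemma orbit_sizeE b p : Phi R M b -> is_period F b p -> orbit_size th b = p.
Proof.
move=> Pb pb; rewrite /orbit_size (zorbitE pb) set_fsetK card_fseq undup_id.
  by rewrite size_map size_traject.
exact: zeta_traject_uniq.
Qed.

Lemma zorbitP b c : Phi R M b -> Phi R M c ->
  zorbit th b (zeta M c) <-> exists i, c = iter i F b.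
Proof.
move=> Pb Pc; have [p pb] := root_period Pb; rewrite (zorbitE pb) /= inE.
split=> [/mapP[_ /trajectP[i _ ->] /zeta_inj e]|[i ->]].
  by exists i; apply: e => //; exact: Phi_iter.
by apply: map_f; exact: iter_traject.
Qed.

Lemma orbit_sumE (a : V -> int) b : Phi R M b ->
  orbit_sum th a b = (\sum_(0 <= t < orbit_size th b) a (iter t F b))%R.
Proof.
move=> Pb; have [p pb] := root_period Pb; rewrite (orbit_sizeE Pb pb) /orbit_sum.
have -> : [set g | Phi R M g /\ zorbit th b (zeta M g)]%classic =
    [set` [fset x in traject F b p]%fset]%classic.
  apply/seteqP; split=> c /=; rewrite inE.
    by move=> [Pc /(zorbitP Pb Pc)[i ->]]; exact: iter_traject.
  move=> /trajectP[i _ ->]; have Pi : Phi R M (iter i F b) by exact: Phi_iter.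
  by split=> //; apply/(zorbitP Pb Pi); exists i.
rewrite set_fsetK big_mkord -(big_mkord xpredT (fun i => a (iter i F b))).
rewrite /index_iota subn0 -(big_map (fun i => iter i F b) xpredT a).
apply: perm_big; apply: uniq_perm; first exact: fset_uniq.
  rewrite map_inj_in_uniq ?iota_uniq // => i j.
  rewrite !mem_iota /= add0n => ip jp /(period_iter pb (@rho_inj th)).
  by rewrite !modn_small.
move=> c; rewrite inE; apply/trajectP/mapP => -[i ip ->]; exists i => //.
  by rewrite mem_iota.
by rewrite mem_iota in ip.
Qed.

Lemma orbit_size_commute (w : W) b : commute w th -> Phi R M b ->
  orbit_size th (rho w b) = orbit_size th b.
Proof.
move=> wth Pb; have [p pb] := root_period Pb.
have iterw n : iter n F (rho w b) = rho w (iter n F b).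
  by elim: n => // n IH; rewrite !iterS IH /F -!rhoM wth.
rewrite (orbit_sizeE Pb pb); apply: orbit_sizeE; first exact: Phi_rho.
case: pb => p0 pE pmin; split=> // [|j jp]; first by rewrite iterw pE.
by rewrite iterw => /rho_inj; exact: pmin.
Qed.

Lemma orbit_sum_commute (w : W) (a : V -> int) b : commute w th -> Phi R M b ->
  orbit_sum th a (rho w b) = orbit_sum th (a \o rho w) b.
Proof.
move=> wth Pb; rewrite !orbit_sumE ?orbit_size_commute //; last exact: Phi_rho.
apply: eq_bigr => i _ /=; congr a.
by elim: i => // i IH; rewrite !iterS IH /F -!rhoM wth.
Qed.

(** Take for h c the sum of [k] along the orbit from its representative, excluded, to [c], included;
    zero orbit sums make it independent of the number of turns. *)
Lemma coboundary (T : set (virtual_artin M)) (k : V -> int) :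
    orbit_representatives R th T ->
    (forall b, Phi R M b -> T (zeta M b) -> orbit_sum th k b = 0%R) ->
  exists h : V -> int, forall c, Phi R M c -> (h (F c) - h c = k (F c))%R.
Proof.
move=> [Tsub Tuniq] k0.
pose Q c v := exists b i, [/\ Phi R M b, T (zeta M b), c = iter i F b &
  v = \sum_(0 <= t < i) k (iter t.+1 F b)]%R.
have /choice[h hQ] : forall c, exists v, Phi R M c -> Q c v.
  move=> c; have [Pc|nPc] := pselect (Phi R M c); last by exists 0%R.
  have [x [[Tx cx] _]] := Tuniq c Pc.
  have [b Pb bx] := Tsub x Tx; rewrite -bx in Tx cx.
  have /(zorbitP Pc Pb)[i bE] := cx.
  have [p [p0 pE pmin]] := root_period Pc.
  (* The representative is [b] = F^i c, and p i - i further steps lead from [b] back to [c]. *)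
  exists (\sum_(0 <= t < p * i - i) k (iter t.+1 F b))%R => _.
  exists b, (p * i - i)%N; split=> //.
  by rewrite bE -iterD subnK ?leq_pmull // (iter_mod _ pE) modnMr.
exists h => c Pc; have PFc : Phi R M (F c) by exact: Phi_rho.
have [b [i [Pb Tb cE ->]]] := hQ c Pc.
have [b' [j [Pb' Tb' FcE ->]]] := hQ _ PFc.
have [p pb] := root_period Pb; have [p' pb'] := root_period Pb'.
have back d e n q : Phi R M e -> is_period F e q -> Phi R M d ->
    d = iter n F e -> zorbit th d (zeta M e).
  move=> Pe [q0 qE _] Pd dE; apply/(zorbitP Pd Pe); exists (q * n - n)%N.
  by rewrite dE -iterD subnK ?leq_pmull // (iter_mod _ qE) modnMr.
(* [c] and [F c] lie in one orbit, hence share its unique representative. *)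
have bb' : b' = b.
  have [x [_ xu]] := Tuniq (F c) PFc; apply: (zeta_inj Pb' Pb).
  transitivity x; first by apply/esym/xu; split=> //; exact: (back _ _ j p').
  by apply: xu; split=> //; apply: (back _ _ i.+1 p) => //; rewrite iterS -cE.
rewrite {b' Pb' Tb' pb'}bb' in FcE *.
(* The step count [j] chosen for [F c] may differ from i + 1 by full turns. *)
rewrite (period_sum (j := i.+1) pb (@rho_inj th)).
- by rewrite big_nat_recr //= -cE addrAC subrr add0r.
- by rewrite -(orbit_sizeE Pb pb) -orbit_sumE // k0.
- by rewrite -FcE cE.
Qed.

End Orbits.

Theorem theorem3p4 (R : realType) (S : finType) (M : coxeter_matrix S)
    (M_spherical : spherical M)
    (a b : rootV R S -> int) (theta : coxeter_group M)
    (w w' : VA_mod_PVA' M)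
    (w_def : w = zeta_prod M a * clsW theta)
    (w'_def : w' = zeta_prod M b * clsW theta)
    (T : set (virtual_artin M)) (T_repr : orbit_representatives R theta T) :
  conjugate w w' <->
  exists eta : VA_mod_PVA' M,
    centralizer theta (piPbar eta) /\
    exists f : rootV R S -> int,
      eta * clsW theta * eta^-1 = zeta_prod M f * clsW theta /\
      forall beta : rootV R S, Phi R M beta -> T (zeta M beta) ->
        (\sum_(0 <= t < orbit_size theta beta) f (iter t (rho theta) beta)
          + orbit_sum theta a (rho (piPbar eta)^-1%g beta)
        = orbit_sum theta b beta)%R.
Proof.
have piw f : piPbar (zeta_prod M f * clsW theta) = theta.
  by rewrite piPbarM piPbar_zeta_prod // mul1g piPbar_clsW.
(* Conjugating by eta = E * g changes the coefficients of w into a o g^-1 + f. *)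
have conjE eta f : centralizer theta (piPbar eta) ->
    eta * clsW theta * eta^-1 = zeta_prod M f * clsW theta ->
    eta * w * eta^-1 =
      zeta_prod M (fun c => a (rho (piPbar eta)^-1 c) + f c)%R * clsW theta.
  move=> etath fE.
  (* Conjugating the two factors of [w] separately: the first has its exponents permuted, the second
     is given by [f]. *)
  have -> : eta * w * eta^-1 = eta * zeta_prod M a * eta^-1 * (zeta_prod M f * clsW theta).
    by rewrite -fE w_def !mulgA mulgVK.
  apply: (VAab_eq (R := R) M_spherical) => [|c Pc].
    by rewrite piw piPbarM piw !piPbarM piPbarV piPbar_zeta_prod // mulg1 mulgV mul1g.
  rewrite lcoef_zeta_prod_clsW // (sdbarM R (eta * zeta_prod M a * eta^-1)) lcoefM.
  rewrite sdbar_piPbar !piPbarM piPbarV piPbar_zeta_prod // mulg1 mulgV invg1 rho1.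
  rewrite lcoef_zeta_prod_clsW //; congr (_ + _)%R.
  rewrite !sdbarM sdbarV lcoef_conj_trans ?sdbar_piPbar ?piPbar_zeta_prod //.
  by rewrite lcoef_zeta_prod //; exact: Phi_rho.
split=> [[eta etaE]|[eta [etath [f [fE fsum]]]]].
  have etath : centralizer theta (piPbar eta).
    rewrite /centralizer /= /commute; have := congr1 (@piPbar _ _) etaE.
    rewrite w_def w'_def !piPbarM piPbarV !piPbar_zeta_prod // !piPbar_clsW !mul1g => {2}->.
    by rewrite mulgVK.
  exists eta; split=> //.
  have [f fE] := zeta_prod_form R M_spherical (eta * clsW theta * eta^-1).
  have pith : piPbar (eta * clsW theta * eta^-1) = theta.
    by rewrite !piPbarM piPbarV piPbar_clsW etath mulgK.
  rewrite pith in fE; exists f; split=> // c Pc _.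
  (* As g = [piPbar eta] commutes with theta, the orbit sum of [a] at g^-1 c is that of a o g^-1 at
     [c]; the identity then holds term by term. *)
  rewrite orbit_sum_commute //; last exact/commute_sym/commuteV/commute_sym.
  rewrite !orbit_sumE // -big_split; apply: eq_bigr => i _ /=.
  have Pi : Phi R M (iter i (rho theta) c) by exact: Phi_iter.
  have := lcoef_zeta_prod_clsW M_spherical b theta Pi.
  by rewrite -w'_def etaE (conjE _ _ etath fE) lcoef_zeta_prod_clsW // addrC.
(* [k] is the defect between w' and the conjugate of [w] by [eta]; the hypothesis says that its
   orbit sums vanish. *)
pose k c := (b c - (a (rho (piPbar eta)^-1 c) + f c))%R.
have [|h hE] := coboundary M_spherical T_repr (k := k).
  move=> c Pc Tc; have := fsum c Pc Tc.
  rewrite orbit_sum_commute //; last exact/commute_sym/commuteV/commute_sym.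
  rewrite !orbit_sumE // -big_split => /esym e.
  by rewrite /k sumrB e -sumrB big1 // => i _ /=; rewrite [(a _ + _)%R]addrC subrr.
exists (zeta_prod M h * eta).
have -> : zeta_prod M h * eta * w * (zeta_prod M h * eta)^-1 =
    zeta_prod M h * (eta * w * eta^-1) * (zeta_prod M h)^-1 by rewrite invgM !mulgA.
rewrite (conjE _ _ etath fE) w'_def; set g := fun c => _.
apply: (VAab_eq (R := R) M_spherical) => [|c Pc].
  by rewrite piw piPbarM piPbarV piPbarM piw piPbar_zeta_prod // invg1 mulg1 mul1g.
rewrite lcoef_zeta_prod_clsW // !sdbarM sdbarV -[_ * sdbar R (clsW theta)]sdbarM.
rewrite lcoef_trans_conj ?sdbar_piPbar ?piPbar_zeta_prod // piw.
rewrite lcoef_zeta_prod_clsW // !lcoef_zeta_prod //; last exact: Phi_rho.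
(* The coboundary equation is taken at theta^-1 c, whose image under theta is [c]. *)
have Pth : Phi R M (rho theta^-1 c) by exact: Phi_rho.
have := hE _ Pth; rewrite -rhoM mulgV rho1 /k -/(g c) => hk.
by rewrite addrAC hk subrK.
Qed.
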